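(* Let $w \ge 3$ be an integer. For $i \in \{0,1,2\}$, let $r_i$ be a positive integer, let $v_i = 2r_i + w + 1$, and suppose there exists a generalized pentagonal geometry $\mathrm{PENT}(3, r_i, w)$ with a deficiency graph of girth $g_i$. Suppose also that $r_0 \equiv 0 \pmod 3$, that $r_1, r_2 \not\equiv 0 \pmod 3$, and that $\gcd(v_1, v_2) = 6$. Let $$t_{\min} = 1 + \max\left(2, \left\lceil \frac{v_0}{v_1}\right\rceil\right),$$ $$u_{\min}(t) = 1 + \max\left(2, \left\lceil \frac{v_1 t + v_1}{v_2}\right\rceil, \left\lceil \frac{v_1 t + v_0}{v_2}\right\rceil\right),$$ $$x_{\min} = u_{\min}\left(t_{\min} + \frac{v_2}{6}\right)$$ and $$r_{\min} = \frac{v_2\, x_{\min}}{2} + \frac{v_1\, t_{\min}}{2} + \frac{v_1 v_2}{6} + \max(r_0, r_1).$$ Then for all integers $r \ge r_{\min}$ with $r \equiv 0$ or $w+1 \pmod 3$, there exists a generalized pentagonal geometry $\mathrm{PENT}(3, r, w)$ with a deficiency graph of girth $\min(g_0, g_1, g_2)$ if $r \equiv 0 \pmod 3$, and of girth $\min(g_1, g_2)$ otherwise.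
   Context: A partial linear space is a (finite) set of points together with a set of lines, each line identified with the set of points incident with it, such that two distinct points lie on at most one common line. Two points are collinear if some line contains both (so a point that lies on a line is collinear with itself). A Steiner system $S(2,k,w)$ is a set of $w$ points with a collection of $k$-subsets (blocks) such that each pair of distinct points is contained in exactly one block. A generalized pentagonal geometry $\mathrm{PENT}(k,r,w)$ is a partial linear space in which every line has exactly $k$ points, every point is on exactly $r$ lines, and for every point $x$ the set of points not collinear with $x$ has size $w$ and is the point set of a Steiner system $S(2,k,w)$ whose blocks are lines of the geometry. Its deficiency graph has the points of the geometry as vertices, with $x \sim y$ precisely when $x$ and $y$ are not collinear. *)

(* Defs.v *)
From mathcomp Require Import all_boot.

Set Implicit Arguments.
Unset Strict Implicit.
Unset Printing Implicit Defensive.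

(** * Finite incidence geometries: a line is the set of its points *)

Section Geometry.

Variable T : finType.
Implicit Types (L B : {set {set T}}) (V : {set T}) (x y : T).

Definition partial_linear_space L : Prop :=
  forall x y, x != y ->
  forall l m, l \in L -> m \in L ->
    x \in l -> y \in l -> x \in m -> y \in m -> l = m.

Definition collinear L : rel T :=
  fun x y => [exists l in L, (x \in l) && (y \in l)].

Definition non_neighbours L x : {set T} := [set y | ~~ collinear L x y].

(* [B] is the block set of a Steiner system S(2, k, w) with point set [V]. *)
Definition steiner2 (k w : nat) V B : Prop :=
  [/\ #|V| = w,
      forall b, b \in B -> b \subset V /\ #|b| = k
    & forall x y, x \in V -> y \in V -> x != y ->
        exists! b, [&& b \in B, x \in b & y \in b]].

Record is_pent (k r w : nat) L : Prop := IsPent {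
  pent_pls : partial_linear_space L;
  pent_line_size : forall l, l \in L -> #|l| = k;
  pent_point_degree : forall x, #|[set l in L | x \in l]| = r;
  pent_steiner : forall x, exists2 B : {set {set T}},
    B \subset L & steiner2 k w (non_neighbours L x) B
}.

(* When every point is on a line, [collinear L] is reflexive, so that this
   relation is irreflexive (and always symmetric): a simple graph. *)
Definition deficiency_graph L : rel T := fun x y => ~~ collinear L x y.

Definition graph_cycle (e : rel T) (c : seq T) : bool :=
  (3 <= size c) && ucycleb e c.

(* Acyclic graphs (infinite girth) satisfy this for no [g]; deficiency graphs
   of the nonempty geometries considered below are [w]-regular with
   [w >= 3], hence not acyclic. In particular, having a girth excludes the
   geometry without points, for which [is_pent] is vacuous. *)
Definition has_girth (e : rel T) (g : nat) : Prop :=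
  (exists2 c, graph_cycle e c & size c = g) /\
  (forall c, graph_cycle e c -> g <= size c).

End Geometry.

Definition exists_pent_girth (k r w g : nat) : Prop :=
  exists (T : finType) (L : {set {set T}}),
    is_pent k r w L /\ has_girth (deficiency_graph L) g.

(** * Numerical bounds *)

(* The ceiling of [a / b], for [0 < b]. *)
Definition ceil_div (a b : nat) : nat := a %/ b + ~~ (b %| a).

Definition t_min (v0 v1 : nat) : nat := 1 + maxn 2 (ceil_div v0 v1).

Definition u_min (v0 v1 v2 t : nat) : nat :=
  1 + maxn 2 (maxn (ceil_div (v1 * t + v1) v2) (ceil_div (v1 * t + v0) v2)).

(* The divisions by 2 and 6 in the next two definitions are exact when
   [gcdn v1 v2 = 6]. *)
Definition x_min (v0 v1 v2 : nat) : nat :=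
  u_min v0 v1 v2 (t_min v0 v1 + v2 %/ 6).

Definition r_min (v0 v1 v2 r0 r1 : nat) : nat :=
  (v2 * x_min v0 v1 v2) %/ 2 + (v1 * t_min v0 v1) %/ 2
  + (v1 * v2) %/ 6 + maxn r0 r1.

(* Main.v *)
Require Import Defs.
From mathcomp Require Import all_boot all_algebra zify.

(* A geometry PENT(3, r, w) can be placed on each group of a group divisible
   design with block size 3; together with the blocks these form a PENT(3, r', w)
   whose deficiency graph is the disjoint union of the old ones, so its girth is the
   minimum of theirs. It remains to find designs of type v2^u (v1 t + v0)^1 and
   v1^t v0^1 (or v1^t v1^1). As v1 and v2 are multiples of 6 this needs, for
   g = 6 h, the existence of a design of type g^t m^1 for all even m <= g (t - 1),
   a case of the theorem of Colbourn, Hoffman and Rees.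

   Write W = 2 h, so g = 3 W, and see the g t points as three levels of t groups of
   size W. Pairs in one level are covered by a design of type W^t p^1, the p new
   points being shared by the levels. Pairs in different levels are covered by
   inflating by W a decomposition of the tensor product K_3 x K_t into classes of
   t disjoint triangles, one class for each nonzero c in Z_t: the triangles
   (x, x + c, x + 2 c), when t is odd. An inflated class is a union of copies of
   K_{W,W,W}, to which any even number m <= 2 W of points can be attached, because
   designs of type W^3 m^1 exist. As p = 0 or W and p = W (t - 1) are possible when
   t is prime to 6, this gives nearly all m. Multiples of 2 and 3 are reduced to
   smaller t by filling groups, and the small m that are left come from
   g^(t-3) (3 g + m)^1 and g^3 m^1. *)

Set Implicit Arguments.
Unset Strict Implicit.
Unset Printing Implicit Defensive.

(** * Triangle decompositions *)

(* Edge decomposition of the graph [e] into triangles, encoded by the function that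
   sends an edge to the third vertex of its triangle. *)
Definition tdec (T : Type) (e : rel T) : Prop :=
  exists f : T -> T -> T, forall x y, e x y ->
    [/\ e x (f x y), f y x = f x y & f x (f x y) = y].

Lemma eq_tdec (T : Type) (e e' : rel T) : e =2 e' -> tdec e -> tdec e'.
Proof.
move=> eqe [f fP]; exists f => x y; rewrite -!eqe => /fP[exf fC fK].
by split; rewrite // -eqe.
Qed.

Lemma tdec0 (T : Type) (e : rel T) : (forall x y, ~~ e x y) -> tdec e.
Proof. by move=> e0; exists (fun x _ => x) => x y; rewrite (negPf (e0 x y)). Qed.

(** Every edge lies in exactly one [E j], which [pick] recovers. The other two sides of its triangle
    lie in the same [E j], so the chosen functions never conflict. *)
Lemma tdec_glue (T : Type) (J : finType) (E : J -> rel T) (e : rel T) :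
    (forall x y, e x y -> exists j, E j x y) ->
    (forall j x y, E j x y -> e x y) ->
    (forall i j x y, E i x y -> E j x y -> i = j) ->
    (forall j, symmetric (E j)) -> (forall j, tdec (E j)) ->
  tdec e.
Proof.
move=> cov sub uniqE symE decE; have [F FP] := fin_all_exists decE.
exists (fun x y => if [pick j | E j x y] is Some j then F j x y else x).
move=> x y exy; case: pickP => [j Ejxy | noE]; last first.
  by have [j] := cov _ _ exy; rewrite noE.
have [Ef fC fK] := FP _ _ _ Ejxy; split; first exact: sub Ef.
  case: pickP => [i | /(_ j)]; last by rewrite symE Ejxy.
  by rewrite symE => Eixy; rewrite -(uniqE _ _ _ _ Ejxy Eixy).
case: pickP => [i Eif | /(_ j)]; last by rewrite Ef.
by rewrite -(uniqE _ _ _ _ Ef Eif).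
Qed.

Section Transfer.

Variables (T0 T : finType) (phi : T0 -> T) (e0 : rel T0) (e : rel T).
Hypotheses (phi_inj : injective phi) (eE : forall x y, e0 x y = e (phi x) (phi y)).
Hypotheses (e_sym : symmetric e) (e_img : forall x y, e x y -> exists x0, phi x0 = x).

Lemma tdec_image : tdec e0 -> tdec e.
Proof.
case=> f fP; pose psi x := [pick x0 | phi x0 == x].
have psiK x0 : psi (phi x0) = Some x0.
  by rewrite /psi; case: pickP => [x1 /eqP/phi_inj-> // | /(_ x0)/eqP].
exists (fun x y => if psi x is Some x0 then
                     if psi y is Some y0 then phi (f x0 y0) else x else x) => x y exy.
have [x0 def_x] := e_img exy; have [y0 def_y] : exists y0, phi y0 = y.
  by apply: (e_img (y := x)); rewrite e_sym.
subst x y; rewrite -eE in exy.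
by have [ef fC fK] := fP _ _ exy; rewrite !psiK -eE fC fK.
Qed.

Lemma tdec_preim : tdec e -> tdec e0.
Proof.
case=> f fP.
exists (fun x y => odflt x [pick z | phi z == f (phi x) (phi y)]) => x y.
rewrite eE => exy; have [ef fC fK] := fP _ _ exy.
have [z def_z] : exists z, phi z = f (phi x) (phi y).
  by apply: (e_img (y := phi x)); rewrite e_sym.
have pickz u v w : f (phi u) (phi v) = phi w ->
    odflt u [pick z | phi z == f (phi u) (phi v)] = w.
  by move->; case: pickP => [w' /eqP/phi_inj | /(_ w)/eqP].
rewrite (pickz x y z) // (pickz y x z) ?fC // (pickz x z y) ?def_z //.
by rewrite eE def_z.
Qed.

End Transfer.

Lemma card_enum (T : finType) (A : {set T}) n : #|A| = n ->
  exists2 h : 'I_n -> T, injective h & forall x, x \in A <-> exists a, h a = x.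
Proof.
move=> <-; exists (@enum_val _ (mem A)) => [|x]; first exact: enum_val_inj.
split=> [Ax | [a <-]]; last exact: enum_valP.
by exists (enum_rank_in Ax x); rewrite enum_rankK_in.
Qed.

(** * Group divisible designs with block size 3 *)

Definition gdd_rel (T : finType) (I : eqType) (S : {set T}) (c : T -> option I) : rel T :=
  fun x y => [&& x \in S, y \in S & c x != c y].

(* There is a group divisible design of block size 3 and type g^t m^1; the group of
   size [m] has colour [None]. Quantifying over all models makes the definition
   independent of a choice of points, cf. [gdd_intro]. *)
Definition gdd (g t m : nat) : Prop :=
  forall (T I : finType) (S : {set T}) (c : T -> option I),
    #|I| = t -> (forall i, #|[set x in S | c x == Some i]| = g) ->
    #|[set x in S | c x == None]| = m -> tdec (gdd_rel S c).

Lemma gdd_rel_sym (T : finType) (I : eqType) (S : {set T}) (c : T -> option I) :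
  symmetric (gdd_rel S c).
Proof. by move=> x y; rewrite /gdd_rel andbCA eq_sym. Qed.

Section Canonical.

Variables (g t m : nat).

Local Notation P := ('I_t * 'I_g + 'I_m)%type.

Let col (p : P) : option 'I_t := if p is inl q then Some q.1 else None.

Lemma gdd_embed (T I : finType) (S : {set T}) (c : T -> option I) :
    #|I| = t -> (forall i, #|[set x in S | c x == Some i]| = g) ->
    #|[set x in S | c x == None]| = m ->
  exists phi : P -> T, [/\ injective phi,
    forall x, x \in S <-> exists p, phi p = x &
    forall p q, (col p != col q) = (c (phi p) != c (phi q))].
Proof.
rewrite -cardsT => cI cg /card_enum[hm hm_inj hmP].
have [iota iota_inj iotaP] := card_enum cI.
have [hg /all_and2[hg_inj hgP]] : exists h : 'I_t -> 'I_g -> T, forall i,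
    injective (h i) /\
    forall x, x \in [set x in S | c x == Some (iota i)] <-> exists a, h i a = x.
  apply: (@fin_all_exists _ _ (fun i hi => injective hi /\
    forall x, x \in [set x in S | c x == Some (iota i)] <-> exists a, hi a = x)).
  by move=> i; have [h] := card_enum (cg (iota i)); exists h.
have cgE i a : hg i a \in S /\ c (hg i a) = Some (iota i).
  have /hgP : exists b, hg i b = hg i a by exists a.
  by rewrite inE => /andP[-> /eqP].
have cmE a : hm a \in S /\ c (hm a) = None.
  have /hmP : exists b, hm b = hm a by exists a.
  by rewrite inE => /andP[-> /eqP].
pose phi (p : P) := match p with inl q => hg q.1 q.2 | inr a => hm a end.
have cphi p : c (phi p) = omap iota (col p).
  by case: p => [[i a]|a]; [have [] := cgE i a | have [] := cmE a].
have colE p q : (col p == col q) = (c (phi p) == c (phi q)).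
  rewrite !cphi; case: (col p) (col q) => [i|] [j|] //=.
  exact/esym/(inj_eq iota_inj).
exists phi; split=> [p q eqpq|x|p q]; last by rewrite colE.
  have := colE p q; rewrite eqpq eqxx.
  case: p q eqpq => [[i a]|a] [[j b]|b] //= /[swap] /eqP; last by move=> _ /hm_inj->.
  by case=> <- /hg_inj->.
split=> [Sx | [[[i a]|a] <-]]; last 2 first.
- by have [] := cgE i a.
- by have [] := cmE a.
case cx: (c x) => [i|]; last first.
  by have /hmP[a <-] : x \in [set x in S | c x == None]; [rewrite inE Sx cx | exists (inr a)].
have /iotaP[j def_i] : i \in [set: I] by [].
have /hgP[a <-] : x \in [set x in S | c x == Some (iota j)] by rewrite inE Sx cx def_i /=.
by exists (inl (j, a)).
Qed.

(** One model suffices: both models are copies of the canonical one on [P], so the decomposition is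
    pulled back to [P] and pushed forward again. *)
Lemma gdd_intro (T I : finType) (S : {set T}) (c : T -> option I) :
    #|I| = t -> (forall i, #|[set x in S | c x == Some i]| = g) ->
    #|[set x in S | c x == None]| = m ->
  tdec (gdd_rel S c) -> gdd g t m.
Proof.
move=> cI cg cm dec T' I' S' c' cI' cg' cm'.
have [phi [phi_inj phiS phiE]] := gdd_embed cI cg cm.
have [phi' [phi'_inj phi'S phi'E]] := gdd_embed cI' cg' cm'.
pose e0 : rel P := fun p q => col p != col q.
have e0E p q : e0 p q = gdd_rel S c (phi p) (phi q).
  by rewrite /gdd_rel -phiE; have [-> ->] : phi p \in S /\ phi q \in S;
    [split; apply/phiS; [exists p | exists q] |].
have e0E' p q : e0 p q = gdd_rel S' c' (phi' p) (phi' q).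
  by rewrite /gdd_rel -phi'E; have [-> ->] : phi' p \in S' /\ phi' q \in S';
    [split; apply/phi'S; [exists p | exists q] |].
apply: (tdec_image phi'_inj e0E' (@gdd_rel_sym _ _ _ _)) => [x y /and3P[/phi'S//]|].
by apply: (tdec_preim phi_inj e0E (@gdd_rel_sym _ _ _ _)) => // x y /and3P[/phiS].
Qed.

End Canonical.

Lemma card_of_inj (T U : finType) (A : {set T}) (h : U -> T) :
  injective h -> (forall x, x \in A <-> exists u, h u = x) -> #|A| = #|U|.
Proof.
move=> h_inj hA; rewrite -(card_codom h_inj); apply: eq_card => x.
apply/idP/idP => [/hA[u <-] | /codomP[u ->]]; first exact: codom_f.
by apply/hA; exists u.
Qed.

(** Settles the points outside a fibre: membership fails by computation, and equality with a witness
    would identify different constructors. *)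
Ltac no_fiber := first [by split=> [|[]] | by split=> [/eqP|[]] | by split=> [/andP[_ /eqP]|[]]].

Lemma gddT (g t m : nat) (T I : finType) (c : T -> option I) :
    gdd g t m -> #|I| = t ->
    (forall i, #|[set x | c x == Some i]| = g) -> #|[set x | c x == None]| = m ->
  tdec (fun x y => c x != c y).
Proof.
move=> dec cI cg cm.
have setTE i : [set x in [set: T] | c x == i] = [set x | c x == i].
  by apply/setP=> x; rewrite !inE.
apply: (@eq_tdec _ (gdd_rel [set: T] c)) => [x y|]; first by rewrite /gdd_rel !inE.
by apply: dec => [|i|]; rewrite ?setTE.
Qed.

Lemma gdd_introT (g t m : nat) (T I : finType) (c : T -> option I) :
    #|I| = t ->
    (forall i, #|[set x | c x == Some i]| = g) -> #|[set x | c x == None]| = m ->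
  tdec (fun x y => c x != c y) -> gdd g t m.
Proof.
move=> cI cg cm dec.
have setTE i : [set x in [set: T] | c x == i] = [set x | c x == i].
  by apply/setP=> x; rewrite !inE.
apply: (@gdd_intro g t m T I [set: T] c) => // [i||]; rewrite ?setTE //.
by apply: eq_tdec dec => x y; rewrite /gdd_rel !inE.
Qed.

(** * Inflating designs, filling their groups and splitting the long group *)

Lemma tdec_inflate (T : Type) (e : rel T) (h : nat) :
  tdec e -> tdec (fun p q : T * 'I_h => e p.1 q.1).
Proof.
case: h => [_|h [f fP]]; first by apply: tdec0 => -[? []].
(* Over each triangle stand the triples of sum zero in Z_h, which form a Latin square; ['I_h] is a
   group only for positive [h], hence the separate case. *)
exists (fun p q => (f p.1 q.1, - (p.2 + q.2))%R) => -[x a] [y b] /= /fP[ef fC fK].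
split=> //; first by rewrite fC GRing.addrC.
by rewrite fK GRing.opprD GRing.opprK GRing.addKr.
Qed.

Lemma gdd_inflate (g t m h : nat) : gdd g t m -> gdd (g * h) t (m * h).
Proof.
move=> dec; pose col (p : 'I_t * 'I_g + 'I_m) := if p is inl q then Some q.1 else None.
have : tdec (fun p q => col p != col q).
  apply: (gddT dec) => [|i|]; first exact: card_ord.
    rewrite (@card_of_inj _ 'I_g _ (fun a => inl (i, a))) ?card_ord // => [a b [] //|].
    case=> [[j a]|a]; rewrite inE /=; last by split=> [/eqP | []].
    by split=> [/eqP[<-] | [b [<-]] //]; exists a.
  rewrite (@card_of_inj _ 'I_m _ inr) ?card_ord // => [a b [] //|].
  by case=> [[j a]|a]; rewrite inE /=; split=> [/eqP | []] // _; exists a.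
move=> /(@tdec_inflate _ _ h); apply: (gdd_introT (c := fun p => col p.1)).
- exact: card_ord.
- move=> i; rewrite (@card_of_inj _ ('I_g * 'I_h)%type _ (fun p => (inl (i, p.1), p.2))).
  + by rewrite card_prod !card_ord.
  + by move=> [a b] [a' b'] [-> ->].
  + case=> [[[j a]|a] b]; rewrite inE /=; last by split=> [/eqP | []].
    by split=> [/eqP[<-] | [[? ?] [<-]] //]; exists (a, b).
rewrite (@card_of_inj _ ('I_m * 'I_h)%type _ (fun p => (inr p.1, p.2))).
- by rewrite card_prod !card_ord.
- by move=> [a b] [a' b'] [-> ->].
by case=> [[[j a]|a] b]; rewrite inE /=; split=> [/eqP | []] // _; exists (a, b).
Qed.

(** A long group of size [g] is one more ordinary group: [c1] gives the last group the colour
    [None], [c2] treats all groups alike, and both separate the same pairs. *)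
Lemma gddS (g t : nat) : gdd g t g <-> gdd g t.+1 0.
Proof.
pose T := ('I_t.+1 * 'I_g)%type.
pose c1 (p : T) := unlift ord_max p.1; pose c2 (p : T) := Some p.1.
have c12 p q : (c1 p != c1 q) = (c2 p != c2 q).
  apply/negb_inj; rewrite !negbK (inj_eq Some_inj) /c1.
  case: unliftP => [i|] ->; case: unliftP => [j|] ->; rewrite ?eqxx //.
    by rewrite (inj_eq Some_inj) (inj_eq lift_inj).
    by rewrite [RHS]eq_sym (negPf (neq_lift _ _)).
  by rewrite (negPf (neq_lift _ _)).
have c1g i : #|[set x | c1 x == Some i]| = g.
  rewrite (@card_of_inj _ 'I_g _ (fun a => (lift ord_max i, a))) ?card_ord // => [a b [] //|].
  case=> j a; rewrite inE /c1 /=; case: unliftP => [k|] ->.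
    split=> [/eqP[->]|[b [eq_ik _]]]; first by exists a.
    by apply/eqP; congr Some; apply: val_inj; apply: can_inj (bumpK t) _ _ (esym eq_ik).
  by split=> [/eqP //|[b [/eqP]]]; rewrite eq_sym (negPf (neq_bump _ _)).
have c1n : #|[set x | c1 x == None]| = g.
  rewrite (@card_of_inj _ 'I_g _ (fun a => (ord_max, a))) ?card_ord // => [a b [] //|].
  case=> j a; rewrite inE /c1 /=; case: unliftP => [k|] ->.
    by split=> [/eqP //|[b [/eqP]]]; rewrite (negPf (neq_bump _ _)).
  by split=> // _; exists a.
have c2g i : #|[set x | c2 x == Some i]| = g.
  rewrite (@card_of_inj _ 'I_g _ (fun a => (i, a))) ?card_ord // => [a b [] //|].
  by case=> j a; rewrite inE; split=> [/eqP[->]|[b [->]] //]; exists a.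
have c2n : #|[set x | c2 x == None]| = 0 by apply: eq_card0 => x; rewrite inE.
split=> dec.
  apply: (gdd_introT _ c2g c2n); first exact: card_ord.
  by apply: eq_tdec (gddT dec _ c1g c1n) => [p q|]; rewrite ?c12 ?card_ord.
apply: (gdd_introT _ c1g c1n); first exact: card_ord.
by apply: eq_tdec (gddT dec _ c2g c2n) => [p q|]; rewrite ?c12 ?card_ord.
Qed.

(** Each group of size [g * k], together with [p] new points common to all of them, receives a
    design of type g^k p^1. The new points join the long group, so no block has to cover a pair made
    of an old and a new point of it. *)
Lemma gdd_fill (g k s M p : nat) :
  gdd (g * k) s M -> gdd g k p -> gdd g (s * k) (M + p).
Proof.
move=> decM decp; pose T := ('I_s * ('I_k * 'I_g) + ('I_M + 'I_p))%type.
pose c (x : T) := if x is inl y then Some (y.1, y.2.1) else None.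
pose S0 := [set x : T | if x is inr (inr _) then false else true].
pose c0 (x : T) := if x is inl y then Some y.1 else None.
pose S1 i := [set x : T | match x with
  | inl y => y.1 == i | inr (inl _) => false | inr (inr _) => true end].
pose c1 (x : T) := if x is inl y then Some y.2.1 else None.
pose E (j : option 'I_s) := if j is Some i then gdd_rel (S1 i) c1 else gdd_rel S0 c0.
apply: (gdd_introT (c := c)).
- by rewrite card_prod !card_ord.
- move=> [i j].
  rewrite (@card_of_inj _ 'I_g _ (fun a => inl (i, (j, a)))) ?card_ord // => [a b [] //|].
  case=> [[i' [j' a]]|[a|a]]; rewrite inE /=; try no_fiber.
  by split=> [/eqP[-> ->] | [b [-> ->]] //]; exists a.
- rewrite (@card_of_inj _ ('I_M + 'I_p)%type _ inr).
  + by rewrite card_sum !card_ord.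
  + by move=> a b [].
  + by case=> [[i' [j' a]]|a]; rewrite inE /=; split=> [/eqP | []] // _; exists a.
apply: (@tdec_glue _ _ E).
- move=> [[i [j a]]|[a|a]] [[i' [j' a']]|[a'|a']] //= cxy;
    try (by exists None; rewrite /E /gdd_rel !inE).
  + have [eqi|nei] := eqVneq i i'.
      exists (Some i); rewrite /E /gdd_rel !inE /= eqi eqxx /=.
      by apply: contra cxy => /eqP[->]; rewrite eqi.
    by exists None; rewrite /E /gdd_rel !inE /= (inj_eq Some_inj).
  + by exists (Some i); rewrite /E /gdd_rel !inE /= eqxx.
  + by exists (Some i'); rewrite /E /gdd_rel !inE /= eqxx.
- case=> [i|] [[i1 [j1 a1]]|[a1|a1]] [[i2 [j2 a2]]|[a2|a2]] //=;
    rewrite /gdd_rel !inE //= ?andbF //.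
    by case/and3P=> _ _; apply: contra => /eqP[_ ->].
  by apply: contra => /eqP[->].
- case=> [i|] [j|] [[i1 [j1 a1]]|[a1|a1]] [[i2 [j2 a2]]|[a2|a2]] //=;
    rewrite /gdd_rel !inE /= ?andbF //.
  + by case/and3P=> /eqP-> _ _ /andP[/eqP->].
  + by case/andP=> /eqP-> _ /andP[/eqP->].
  + by case/andP=> /eqP-> _ /andP[/eqP->].
  + by case/and3P=> /eqP-> /eqP-> _ /eqP.
  + by move=> /eqP ne /and3P[/eqP e1 /eqP e2]; case: ne; rewrite e1 e2.
- by case=> [i|]; apply: gdd_rel_sym.
case=> [i|].
  apply: decp => [|j|]; first exact: card_ord.
    rewrite (@card_of_inj _ 'I_g _ (fun a => inl (i, (j, a)))) ?card_ord // => [a b [] //|].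
    case=> [[i' [j' a]]|[a|a]]; rewrite !inE /=; try no_fiber.
    by split=> [/andP[/eqP-> /eqP[->]] | [b [-> ->]]]; [exists a | rewrite !eqxx].
  rewrite (@card_of_inj _ 'I_p _ (fun a => inr (inr a))) ?card_ord // => [a b [] //|].
  case=> [[i' [j' a]]|[a|a]]; rewrite !inE /=; try no_fiber.
  by split=> // _; exists a.
apply: decM => [|i|]; first exact: card_ord.
  rewrite (@card_of_inj _ ('I_g * 'I_k)%type _ (fun a => inl (i, (a.2, a.1)))).
  - by rewrite card_prod !card_ord.
  - by move=> [a b] [a' b'] [-> ->].
  case=> [[i' [j' a]]|[a|a]]; rewrite !inE /=; try no_fiber.
  by split=> [/eqP[->] | [b [->]] //]; exists (a, j').
rewrite (@card_of_inj _ 'I_M _ (fun a => inr (inl a))) ?card_ord // => [a b [] //|].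
case=> [[i' [j' a]]|[a|a]]; rewrite !inE /=; try no_fiber.
by split=> // _; exists a.
Qed.

(** The long group of the first design carries the second design. *)
Lemma gdd_split (g t l m : nat) :
  gdd g t (g * l + m) -> gdd g l m -> gdd g (t + l) m.
Proof.
move=> dec1 dec2; pose T := ('I_t * 'I_g + ('I_l * 'I_g + 'I_m))%type.
pose c (x : T) : option ('I_t + 'I_l) :=
  match x with inl y => Some (inl y.1) | inr (inl y) => Some (inr y.1) | _ => None end.
pose c1 (x : T) := if x is inl y then Some y.1 else None.
pose S2 := [set x : T | if x is inl _ then false else true].
pose c2 (x : T) := if x is inr (inl y) then Some y.1 else None.
pose E (b : bool) := if b then gdd_rel [set: T] c1 else gdd_rel S2 c2.
apply: (gdd_introT (c := c)).
- by rewrite card_sum !card_ord.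
- case=> i.
    rewrite (@card_of_inj _ 'I_g _ (fun a => inl (i, a))) ?card_ord // => [a b [] //|].
    case=> [[j a]|[[j a]|a]]; rewrite inE /=; try no_fiber.
    by split=> [/eqP[->] | [b [->]] //]; exists a.
  rewrite (@card_of_inj _ 'I_g _ (fun a => inr (inl (i, a)))) ?card_ord // => [a b [] //|].
  case=> [[j a]|[[j a]|a]]; rewrite inE /=; try no_fiber.
  by split=> [/eqP[->] | [b [->]] //]; exists a.
- rewrite (@card_of_inj _ 'I_m _ (fun a => inr (inr a))) ?card_ord // => [a b [] //|].
  case=> [[j a]|[[j a]|a]]; rewrite inE /=; try no_fiber.
  by split=> // _; exists a.
apply: (@tdec_glue _ _ E).
- move=> [[i a]|[[i a]|a]] [[i' a']|[[i' a']|a']] //= cxy;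
    try (by exists true; rewrite /E /gdd_rel !inE);
    by exists false; rewrite /E /gdd_rel !inE.
- by case=> [] [[i a]|[[i a]|a]] [[i' a']|[[i' a']|a']]; rewrite /= /gdd_rel !inE.
- by case=> [] [] [[i a]|[[i a]|a]] [[i' a']|[[i' a']|a']]; rewrite /= /gdd_rel !inE.
- by case; apply: gdd_rel_sym.
case.
  apply: dec1 => [|i|]; first exact: card_ord.
    rewrite (@card_of_inj _ 'I_g _ (fun a => inl (i, a))) ?card_ord // => [a b [] //|].
    case=> [[j a]|[[j a]|a]]; rewrite !inE /=; try no_fiber.
    by split=> [/eqP[->] | [b [->]] //]; exists a.
  rewrite (@card_of_inj _ ('I_l * 'I_g + 'I_m)%type _ inr) => [|a b [] //|].
    by rewrite card_sum card_prod !card_ord mulnC.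
  by case=> [[j a]|a]; rewrite !inE /=; split=> [/eqP | []] // _; exists a.
apply: dec2 => [|i|]; first exact: card_ord.
  rewrite (@card_of_inj _ 'I_g _ (fun a => inr (inl (i, a)))) ?card_ord // => [a b [] //|].
  case=> [[j a]|[[j a]|a]]; rewrite !inE /=; try no_fiber.
  by split=> [/eqP[->] | [b [->]] //]; exists a.
rewrite (@card_of_inj _ 'I_m _ (fun a => inr (inr a))) ?card_ord // => [a b [] //|].
case=> [[j a]|[[j a]|a]]; rewrite !inE /=; try no_fiber.
by split=> // _; exists a.
Qed.

(** * Weighting *)

(* The graph [e0] with each vertex replaced by [W] independent copies, joined to an
   independent set [Q]. *)
Definition weighted (L : finType) (e0 : rel L) (W : nat) (Q : Type) : rel (L * 'I_W + Q) :=
  fun p q => match p, q with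
    | inl x, inl y => e0 x.1 y.1
    | inr _, inr _ => false
    | _, _ => true
  end.
Arguments weighted : clear implicits.

(* Wilson's fundamental construction. The blocks [b j], for [J0 j], are the triangles
   of a decomposition of [e0]; those with [k j = Some c] form a parallel class, and the
   elements of [cls @^-1 c] are attached to that class. *)
Section Weighting.

Variables (L C J Q : finType) (J0 : pred J) (b : J -> 'I_3 -> L) (k : J -> option C).
Variables (e0 : rel L) (W : nat) (cls : Q -> C).

Hypothesis e0_irr : irreflexive e0.
Hypothesis block_edge : forall j i i', J0 j -> i != i' -> e0 (b j i) (b j i').
Hypothesis edge_block : forall x y, e0 x y ->
  exists2 j, J0 j & exists i i', b j i = x /\ b j i' = y.
Hypothesis edge_block_uniq : forall j j' i1 i2 i1' i2', J0 j -> J0 j' ->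
  i1 != i2 -> b j i1 = b j' i1' -> b j i2 = b j' i2' -> j = j'.
Hypothesis class_block : forall x c,
  exists2 j, J0 j & k j = Some c /\ exists i, b j i = x.
Hypothesis class_block_uniq : forall j j' i i' c, J0 j -> J0 j' ->
  k j = Some c -> k j' = Some c -> b j i = b j' i' -> j = j'.
Hypothesis gddW : forall m, ~~ odd m -> m <= 2 * W -> gdd W 3 m.
Hypothesis cls_even : forall c,
  ~~ odd #|[set q | cls q == c]| /\ #|[set q | cls q == c]| <= 2 * W.

Local Notation T := (L * 'I_W + Q)%type.

Definition block_points (j : J) : {set T} := [set p : T | match p with
  | inl x => x.1 \in codom (b j)
  | inr q => k j == Some (cls q) end].

Definition block_colour (j : J) (p : T) : option 'I_3 :=
  if p is inl x then [pick i | b j i == x.1] else None.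

Arguments block_colour : simpl never.

Local Notation S := block_points.
Local Notation col := block_colour.

Let b_inj j : J0 j -> injective (b j).
Proof.
move=> Jj i i' eqb; apply/eqP; case: eqVneq => // /(block_edge Jj).
by rewrite eqb e0_irr.
Qed.

Let colE j i a : J0 j -> col j (inl (b j i, a)) = Some i.
Proof.
move=> Jj; rewrite /block_colour /=; case: pickP => [i' /eqP/(b_inj Jj)-> // | /(_ i)].
by rewrite eqxx.
Qed.

(** Block [j] carries a design of type W^3 m^1, whose long group consists of the points attached to
    the class of [j]. A pair of old points meets one block; an old point and a new point [q] meet in
    the one block of class [cls q] through the old point. *)
Lemma tdec_weighted : tdec (weighted L e0 W Q).
Proof.
apply: (@tdec_glue _ _ (fun j p q => J0 j && gdd_rel (S j) (col j) p q)).
- move=> [[x a]|q] [[y a']|q'] //=.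
  + move=> e0xy; have [j Jj [i [i' [def_x def_y]]]] := edge_block e0xy; subst x y.
    exists j; rewrite Jj /gdd_rel !colE // !inE /= !codom_f.
    by apply: contraTneq e0xy => -[->]; rewrite e0_irr.
  + move=> _; have [j Jj [kj [i def_x]]] := class_block x (cls q'); subst x.
    by exists j; rewrite Jj /gdd_rel colE // !inE /= codom_f kj eqxx.
  + move=> _; have [j Jj [kj [i def_y]]] := class_block y (cls q); subst y.
    by exists j; rewrite Jj /gdd_rel colE // !inE /= codom_f kj eqxx.
- move=> j [[x a]|q] [[y a']|q'] //=; rewrite /gdd_rel ?andbF // => /and4P[Jj].
  rewrite !inE /= => /codomP[i ->] /codomP[i' ->]; rewrite !colE // => nei.
  exact: block_edge.
- move=> j j' [[x a]|q] [[y a']|q'] //=; rewrite /gdd_rel ?andbF // => /and4P[Jj];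
    rewrite !inE /=.
  + move=> /codomP[i1 ->] /codomP[i2 ->]; rewrite !colE // (inj_eq Some_inj) => ne.
    case/and4P=> Jj'; rewrite ?inE /= => /codomP[i1' eq1] /codomP[i2' eq2] _.
    exact: edge_block_uniq Jj Jj' ne eq1 eq2.
  + move=> /codomP[i1 ->] /eqP kj _ /and4P[Jj']; rewrite ?inE /=.
    move=> /codomP[i1' eq1] /eqP kj' _; exact: class_block_uniq Jj Jj' kj kj' eq1.
  + move=> /eqP kj /codomP[i1 ->] _ /and4P[Jj']; rewrite ?inE /=.
    move=> /eqP kj' /codomP[i1' eq1] _; exact: class_block_uniq Jj Jj' kj kj' eq1.
- by move=> j p q; rewrite gdd_rel_sym.
move=> j; case Jj: (J0 j) => /=; last exact: tdec0.
have [odd_kj le_kj] : ~~ odd #|[set p in S j | col j p == None]| /\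
    #|[set p in S j | col j p == None]| <= 2 * W.
  have noneE p : (p \in [set p in S j | col j p == None]) =
      if p is inr q then k j == Some (cls q) else false.
    case: p => [[x a]|q]; rewrite !inE /= ?andbT //.
    by apply/negbTE/negP => /andP[/codomP[i ->]]; rewrite colE.
  case kj: (k j) => [c|]; last first.
    suff -> : [set p in S j | col j p == None] = set0 by rewrite cards0.
    by apply/setP=> p; rewrite noneE in_set0; case: p => // q; rewrite kj.
  suff -> : [set p in S j | col j p == None] = inr @: [set q | cls q == c].
    by rewrite card_imset; [apply: cls_even | move=> q q' []].
  apply/setP=> p; rewrite noneE; apply/idP/imsetP => [|[q]].
    case: p => // q; rewrite kj => /eqP[def_c]; exists q => //.
    by rewrite inE def_c.
  by rewrite inE => /eqP cq ->; rewrite kj cq.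
apply: (gddW odd_kj le_kj) => [|i|] //; first exact: card_ord.
rewrite (@card_of_inj _ 'I_W _ (fun a => inl (b j i, a))) ?card_ord // => [a a' [] //|].
case=> [[x a]|q]; rewrite !inE /=; last by split=> [/andP[_ /eqP]|[]].
split=> [/andP[/codomP[i' ->]]|[a' [<- _]]]; last by rewrite codom_f colE /=.
by rewrite colE // => /eqP[->]; exists a.
Qed.

End Weighting.

(* The new points come in pairs, which keeps the fibres of [cls] even. *)
Lemma even_classes (C : finType) (W n : nat) : n <= W * #|C| ->
  exists cls : 'I_n * bool -> C, forall c,
    ~~ odd #|[set q | cls q == c]| /\ #|[set q | cls q == c]| <= 2 * W.
Proof.
(* Pair number [a] goes to class [a %/ W], so a class receives at most [W] pairs, that is [2 * W]
   points. For [W = 0] there are no pairs. *)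
move=> le_n; have lt_div (a : 'I_n) : a %/ W < #|C|.
  case: W le_n => [|W] le_n; last by rewrite ltn_divLR // mulnC (leq_trans (ltn_ord a)).
  by have := leq_trans (ltn_ord a) le_n.
exists (fun q => enum_val (Ordinal (lt_div q.1))) => c.
set F := [set q | _]; pose G := [set a | enum_val (Ordinal (lt_div a)) == c].
have -> : F = setX G [set: bool] by apply/setP=> p; rewrite !inE andbT.
rewrite cardsX cardsT card_bool oddM andbF; split=> //.
rewrite mulnC leq_mul2l /=; case: (posnP W) => [W0|W_gt0].
  rewrite W0 mul0n leqn0 in le_n.
  by rewrite W0 (leq_trans (max_card _)) // card_ord (eqP le_n).
pose f a := Ordinal (ltn_pmod (val (a : 'I_n)) W_gt0).
rewrite -[W in _ <= W]card_ord -(@card_in_imset _ _ f) ?max_card // => a a'.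
rewrite !inE => /eqP <- /eqP/enum_val_inj[eq_div] [eq_mod].
by apply: val_inj; rewrite /= (divn_eq a W) (divn_eq a' W) eq_div eq_mod.
Qed.

(** * Parallel classes from orthogonal arrays *)

Definition level_rel (X : Type) (E : rel X) : rel ('I_3 * X) :=
  fun x y => (x.1 != y.1) && E x.2 y.2.

(* [beta _ c x] is the row of the array in class [c] and position [x]. *)
Definition orth_array (X : finType) (beta : 'I_3 -> X -> X -> X) : Prop :=
  (forall i c, injective (beta i c)) /\
  (forall i j, i != j -> injective (fun p : X * X => (beta i p.1 p.2, beta j p.1 p.2))).

(** The rows of class [c] form a parallel class because every column is a bijection in [x]; a pair
    from two levels lies in exactly one row because the two columns are orthogonal. The classes with
    [P c] are those whose rows consist of edges. *)
Lemma tdec_orth_array (X : finType) (beta : 'I_3 -> X -> X -> X) (P : pred X) (E : rel X) W n :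
    orth_array beta ->
    (forall i j c x, i != j -> E (beta i c x) (beta j c x) = P c) ->
    (forall m, ~~ odd m -> m <= 2 * W -> gdd W 3 m) -> n <= W * #|P| ->
  tdec (weighted ('I_3 * X)%type (level_rel E) W ('I_n * bool)%type).
Proof.
move=> [inj1 inj2] EP gddW; rewrite -card_sig => le_n.
have [cls clsP] := even_classes le_n.
pose J0 (j : X * X) := P j.1; pose b (j : X * X) i := (i, beta i j.1 j.2).
apply: (@tdec_weighted _ {c | P c} _ _ J0 b (fun j => insub j.1) _ _ cls) => //.
- by move=> [i x]; rewrite /level_rel /= eqxx.
- by move=> [c x] i i' Pc ne; rewrite /level_rel ne EP.
- move=> [i x] [j y] /andP[/= ne Exy].
  have /codomP[[c z] /= [def_x def_y]] := injF_onto (inj2 i j ne) (x, y).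
  exists (c, z); last by exists i, j; rewrite /b /= -def_x -def_y.
  by rewrite /J0 /= -(EP _ _ c z ne) -def_x -def_y.
- move=> [c x] [c' x'] i1 i2 i1' i2' _ _ ne [<- eq1] [<- eq2].
  by apply: (inj2 _ _ ne); rewrite /= eq1 eq2.
- move=> [i x] [c Pc].
  have /codomP[z def_x] := injF_onto (inj1 i c) x.
  by exists (c, z) => //; split; [rewrite /= insubT | exists i; rewrite /b /= -def_x].
move=> [c x] [c' x'] i i' [d Pd] _ _ /= kc kc' [<- eq_b].
have ins_eq u : insub u = Some (exist _ d Pd) :> option {c | P c} -> u = d.
  by case: insubP => // v _ <- [->].
move: kc kc' eq_b => /ins_eq-> /ins_eq->.
by move/inj1->.
Qed.

(** Class [c0] is the diagonal. By orthogonality no other row repeats an entry, so dropping [c0]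
    removes exactly the pairs in equal positions. *)
Lemma tdec_idempotent_array (X : finType) (beta : 'I_3 -> X -> X -> X) (c0 : X) W n :
    orth_array beta -> (forall i x, beta i c0 x = x) ->
    (forall m, ~~ odd m -> m <= 2 * W -> gdd W 3 m) -> n <= W * #|X|.-1 ->
  tdec (weighted ('I_3 * X)%type (level_rel (fun x y => x != y)) W ('I_n * bool)%type).
Proof.
move=> oa idem gddW le_n; have [inj1 inj2] := oa.
apply: (tdec_orth_array (P := predC1 c0) oa) => //.
- move=> i j c x ne /=; apply: negb_inj; rewrite !negbK; apply/eqP/eqP => [eqx | ->].
    have [//] : (c, x) = (c0, beta i c x); apply: (inj2 i j ne).
    by rewrite /= !idem -eqx.
  by rewrite !idem.
- by rewrite cardC1.
Qed.

(** All #|X| parallel classes are kept, and each of them absorbs up to [2 * w] new points. *)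
Lemma gdd_orth_array (X : finType) (beta : 'I_3 -> X -> X -> X) w m :
    orth_array beta -> (forall m, ~~ odd m -> m <= 2 * w -> gdd w 3 m) ->
  ~~ odd m -> m <= 2 * (w * #|X|) -> gdd (w * #|X|) 3 m.
Proof.
move=> oa gddw even_m le_m; have def_m : m = m./2 * 2 by lia.
pose c (p : ('I_3 * X) * 'I_w + 'I_m./2 * bool) := if p is inl x then Some x.1.1 else None.
apply: (gdd_introT (c := c)).
- exact: card_ord.
- move=> i; rewrite (@card_of_inj _ ('I_w * X)%type _ (fun a => inl ((i, a.2), a.1))).
  + by rewrite card_prod card_ord.
  + by move=> [a x] [a' x'] [-> ->].
  case=> [[[j x] a]|q]; rewrite inE /=; try no_fiber.
  by split=> [/eqP[->] | [b [->]] //]; exists (a, x).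
- rewrite (@card_of_inj _ ('I_m./2 * bool)%type _ inr) => [|a b [] //|].
    by rewrite card_prod card_ord card_bool -def_m.
  by case=> [[[j x] a]|q]; rewrite inE /=; try no_fiber; split=> // _; exists q.
apply: eq_tdec (@tdec_orth_array _ _ predT (fun _ _ => true) w m./2 oa _ gddw _) => //.
  by case=> [[[i x] a]|q] [[[j y] b]|q'] //=; rewrite /level_rel andbT.
have -> : #|(predT : pred X)| = #|X| by apply: eq_card.
by lia.
Qed.

(** * Three equal groups *)

Fixpoint third (s : seq (nat * nat * nat)) (x y : nat) : nat :=
  if s is (a, b, c) :: s' then
    if (x \in [:: a; b; c]) && (y \in [:: a; b; c]) then a + b + c - x - y
    else third s' x y
  else 0.

(** Points are numbered group by group; the truncation at [t] merges everything from [g * t] on into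
    the long group. *)
Definition table_colour (g t x : nat) : nat := minn (x %/ g) t.

Definition triples_ok (g t m : nat) (s : seq (nat * nat * nat)) : bool :=
  let N := iota 0 (g * t + m) in let c := table_colour g t in
  all (fun x => all (fun y => (c x != c y) ==>
    let z := third s x y in
    [&& z < g * t + m, c x != c z, third s y x == z & third s x z == y]) N) N.

(** [insub] sends all numbers from [t] on to [None], just as the truncation sends them to [t]. *)
Lemma eq_insub_ord (t u v : nat) :
  ((insub u : option 'I_t) == insub v) = (minn u t == minn v t).
Proof.
case: insubP => [i lt_u def_u|]; case: insubP => [j lt_v def_v|]; rewrite -?leqNgt => *.
- rewrite -[LHS]/(val i == val j) def_u def_v.
  by rewrite (minn_idPl (ltnW lt_u)) (minn_idPl (ltnW lt_v)).
- by rewrite -[LHS]/false; apply/esym/eqP; lia.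
- by rewrite -[LHS]/false; apply/esym/eqP; lia.
- by rewrite eqxx; apply/esym/eqP; lia.
Qed.

(** The boolean check spells out the equations of [tdec] for [third s], on points represented by
    numbers, so a table can be verified by computation. *)
Lemma gdd_of_triples (g t m : nat) (s : seq (nat * nat * nat)) :
  0 < g -> triples_ok g t m s -> gdd g t m.
Proof.
move=> g_gt0 /allP ok; pose c (x : 'I_(g * t + m)) : option 'I_t := insub (x %/ g).
have cE (x y : 'I__) : (c x != c y) = (table_colour g t x != table_colour g t y).
  by rewrite /c eq_insub_ord.
apply: (gdd_introT (c := c)); first exact: card_ord.
- move=> i; have lt_ia (a : 'I_g) : i * g + a < g * t + m.
    have := leq_mul (ltn_ord i) (leqnn g); have := ltn_ord a; lia.
  rewrite (@card_of_inj _ 'I_g _ (fun a => Ordinal (lt_ia a))) ?card_ord //.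
    by move=> a b [/addnI eq_ab]; apply: val_inj.
  move=> x; rewrite inE /c; split=> [/eqP | [a <-]]; last first.
    by rewrite /= divnMDl // divn_small // addn0 valK.
  case: insubP => // j _ def_j [eq_ji]; exists (Ordinal (ltn_pmod x g_gt0)).
  by apply: val_inj; rewrite /= -eq_ji [nat_of_ord j]def_j -divn_eq.
- have lt_a (a : 'I_m) : g * t + a < g * t + m by rewrite ltn_add2l.
  rewrite (@card_of_inj _ 'I_m _ (fun a => Ordinal (lt_a a))) ?card_ord //.
    by move=> a b [/addnI eq_ab]; apply: val_inj.
  move=> x; rewrite inE /c; split=> [/eqP | [a <-]]; last first.
    by rewrite insubF //= ltnNge leq_divRL // mulnC leq_addr.
  case: insubP => // ; rewrite -leqNgt leq_divRL // mulnC => le_x _.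
  have lt_xm : x - g * t < m by have := ltn_ord x; lia.
  by exists (Ordinal lt_xm); apply: val_inj; rewrite /= subnKC.
exists (fun x y : 'I_(g * t + m) => insubd x (third s x y)) => x y.
have in_iota (z : 'I_(g * t + m)) : nat_of_ord z \in iota 0 (g * t + m).
  by rewrite mem_iota ltn_ord.
have /allP/(_ _ (in_iota y))/implyP := ok _ (in_iota x).
rewrite !cE => /[apply] /and4P[lt_z cz /eqP tC /eqP tK].
have def_z : val (insubd x (third s x y)) = third s x y by rewrite val_insubd lt_z.
split.
- by rewrite [nat_of_ord (insubd _ _)]def_z.
- by apply: val_inj; rewrite !val_insubd tC lt_z.
by apply: val_inj; rewrite val_insubd [nat_of_ord (insubd _ _)]def_z tK ltn_ord.
Qed.

(** * Small designs verified by computation *)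

Lemma gdd_2_3_2 : gdd 2 3 2.
Proof.
by apply: (@gdd_of_triples _ _ _
    [:: (0, 2, 6); (0, 3, 4); (0, 5, 7); (1, 2, 5); (1, 3, 7); (1, 4, 6); (2, 4, 7);
        (3, 5, 6)]); vm_compute.
Qed.

Lemma gdd_2_3_4 : gdd 2 3 4.
Proof.
by apply: (@gdd_of_triples _ _ _
    [:: (0, 2, 7); (0, 3, 8); (0, 4, 6); (0, 5, 9); (1, 2, 9); (1, 3, 6); (1, 4, 7);
        (1, 5, 8); (2, 4, 8); (2, 5, 6); (3, 4, 9); (3, 5, 7)]); vm_compute.
Qed.

Lemma gdd_4_3_2 : gdd 4 3 2.
Proof.
by apply: (@gdd_of_triples _ _ _
    [:: (0, 4, 13); (0, 5, 10); (0, 6, 8); (0, 7, 9); (0, 11, 12); (1, 4, 10); (1, 5, 11);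
        (1, 6, 9); (1, 7, 13); (1, 8, 12); (2, 4, 11); (2, 5, 9); (2, 6, 12); (2, 7, 8);
        (2, 10, 13); (3, 4, 8); (3, 5, 12); (3, 6, 10); (3, 7, 11); (3, 9, 13); (4, 9, 12);
        (5, 8, 13); (6, 11, 13); (7, 10, 12)]); vm_compute.
Qed.

Lemma gdd_4_3_4 : gdd 4 3 4.
Proof.
by apply: (@gdd_of_triples _ _ _
    [:: (0, 4, 10); (0, 5, 13); (0, 6, 15); (0, 7, 11); (0, 8, 14); (0, 9, 12); (1, 4, 12);
        (1, 5, 8); (1, 6, 10); (1, 7, 14); (1, 9, 13); (1, 11, 15); (2, 4, 15); (2, 5, 11);
        (2, 6, 9); (2, 7, 12); (2, 8, 13); (2, 10, 14); (3, 4, 8); (3, 5, 14); (3, 6, 13);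
        (3, 7, 9); (3, 10, 15); (3, 11, 12); (4, 9, 14); (4, 11, 13); (5, 9, 15);
        (5, 10, 12); (6, 8, 12); (6, 11, 14); (7, 8, 15); (7, 10, 13)]); vm_compute.
Qed.

Lemma gdd_4_3_6 : gdd 4 3 6.
Proof.
by apply: (@gdd_of_triples _ _ _
    [:: (0, 4, 17); (0, 5, 9); (0, 6, 16); (0, 7, 13); (0, 8, 15); (0, 10, 14);
        (0, 11, 12); (1, 4, 11); (1, 5, 15); (1, 6, 17); (1, 7, 14); (1, 8, 16);
        (1, 9, 13); (1, 10, 12); (2, 4, 15); (2, 5, 16); (2, 6, 10); (2, 7, 12);
        (2, 8, 14); (2, 9, 17); (2, 11, 13); (3, 4, 14); (3, 5, 12); (3, 6, 13); (3, 7, 8);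
        (3, 9, 15); (3, 10, 17); (3, 11, 16); (4, 8, 13); (4, 9, 12); (4, 10, 16);
        (5, 8, 17); (5, 10, 13); (5, 11, 14); (6, 8, 12); (6, 9, 14); (6, 11, 15);
        (7, 9, 16); (7, 10, 15); (7, 11, 17)]); vm_compute.
Qed.

Lemma gdd_4_3_8 : gdd 4 3 8.
Proof.
by apply: (@gdd_of_triples _ _ _
    [:: (0, 4, 18); (0, 5, 17); (0, 6, 12); (0, 7, 14); (0, 8, 15); (0, 9, 16);
        (0, 10, 19); (0, 11, 13); (1, 4, 17); (1, 5, 15); (1, 6, 16); (1, 7, 12);
        (1, 8, 14); (1, 9, 19); (1, 10, 13); (1, 11, 18); (2, 4, 16); (2, 5, 19);
        (2, 6, 15); (2, 7, 13); (2, 8, 18); (2, 9, 12); (2, 10, 17); (2, 11, 14);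
        (3, 4, 14); (3, 5, 13); (3, 6, 19); (3, 7, 18); (3, 8, 17); (3, 9, 15);
        (3, 10, 16); (3, 11, 12); (4, 8, 19); (4, 9, 13); (4, 10, 12); (4, 11, 15);
        (5, 8, 12); (5, 9, 18); (5, 10, 14); (5, 11, 16); (6, 8, 13); (6, 9, 14);
        (6, 10, 18); (6, 11, 17); (7, 8, 16); (7, 9, 17); (7, 10, 15); (7, 11, 19)]); vm_compute.
Qed.

Lemma gdd_2_4_0 : gdd 2 4 0.
Proof.
by apply: (@gdd_of_triples _ _ _
    [:: (0, 2, 5); (0, 3, 6); (0, 4, 7); (1, 2, 7); (1, 3, 4); (1, 5, 6); (2, 4, 6);
        (3, 5, 7)]); vm_compute.
Qed.

Lemma gdd_2_4_6 : gdd 2 4 6.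
Proof.
by apply: (@gdd_of_triples _ _ _
    [:: (0, 2, 12); (0, 3, 9); (0, 4, 10); (0, 5, 8); (0, 6, 11); (0, 7, 13); (1, 2, 8);
        (1, 3, 13); (1, 4, 12); (1, 5, 11); (1, 6, 9); (1, 7, 10); (2, 4, 13); (2, 5, 9);
        (2, 6, 10); (2, 7, 11); (3, 4, 11); (3, 5, 10); (3, 6, 12); (3, 7, 8); (4, 6, 8);
        (4, 7, 9); (5, 6, 13); (5, 7, 12)]); vm_compute.
Qed.

Lemma gdd_2_6_0 : gdd 2 6 0.
Proof.
by apply: (@gdd_of_triples _ _ _
    [:: (0, 2, 5); (0, 3, 10); (0, 4, 6); (0, 7, 8); (0, 9, 11); (1, 2, 10); (1, 3, 8);
        (1, 4, 11); (1, 5, 7); (1, 6, 9); (2, 4, 9); (2, 6, 8); (2, 7, 11); (3, 4, 7);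
        (3, 5, 9); (3, 6, 11); (4, 8, 10); (5, 6, 10); (5, 8, 11); (7, 9, 10)]); vm_compute.
Qed.

Lemma gdd_2_7_0 : gdd 2 7 0.
Proof.
by apply: (@gdd_of_triples _ _ _
    [:: (0, 2, 11); (0, 3, 6); (0, 4, 12); (0, 5, 13); (0, 7, 8); (0, 9, 10); (1, 2, 9);
        (1, 3, 5); (1, 4, 6); (1, 7, 12); (1, 8, 11); (1, 10, 13); (2, 4, 13); (2, 5, 7);
        (2, 6, 8); (2, 10, 12); (3, 4, 11); (3, 7, 10); (3, 8, 13); (3, 9, 12); (4, 7, 9);
        (4, 8, 10); (5, 6, 10); (5, 8, 12); (5, 9, 11); (6, 9, 13); (6, 11, 12);
        (7, 11, 13)]); vm_compute.
Qed.


(** * Orthogonal arrays of odd order and of order 4 *)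

Lemma ord_odd_double_inj (n : nat) (d : 'I_n.+1) : odd n.+1 -> (d *+ 2 = 0)%R -> d = 0%R.
Proof.
(* The odd order [n.+1] annihilates [d]; removing the multiples of [d *+ 2] leaves [d] itself. *)
move=> n_odd d2; have : (d *+ (1 + 2 * n.+1./2) = 0)%R.
  have -> : 1 + 2 * n.+1./2 = n.+1 by lia.
  by rewrite Zp_mulrn; apply: val_inj; rewrite /= modnMl.
by rewrite GRing.mulrS GRing.mulrnA d2 GRing.mul0rn GRing.addr0.
Qed.

(** The columns are x, x + c and x + 2 c. If two columns agree on two rows, the difference of the
    two values of c is killed by 1 or by 2, and 2 is invertible in odd order. *)
Lemma orth_array_odd (n : nat) : odd n.+1 ->
  orth_array (fun i (c x : 'I_n.+1) => x + c *+ (i : 'I_3))%R.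
Proof.
move=> n_odd; split=> [i c x y /GRing.addIr // | i j ne [c x] [c' x'] eq_xx].
have eq_i : (x + c *+ i = x' + c' *+ i)%R := congr1 fst eq_xx.
have eq_j : (x + c *+ j = x' + c' *+ j)%R := congr1 snd eq_xx.
suff eqc : c = c'.
  by rewrite eqc in eq_i *; rewrite (GRing.addIr _ eq_i).
have eq_d (l : 'I_3) : (x + c *+ l = x' + c' *+ l -> x' - x = (c - c') *+ l)%R.
  move=> eq_l; have -> : x' = (x + c *+ l - c' *+ l)%R by rewrite eq_l GRing.addrK.
  by rewrite GRing.mulrnBl -[(x + _ - _)%R]GRing.addrA [LHS]GRing.addrC GRing.addKr.
have eq_ij : ((c - c') *+ i = (c - c') *+ j)%R by rewrite -!eq_d.
suff : (c - c')%R = 0%R by move/GRing.subr0_eq.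
move: (c - c')%R eq_ij => d {eq_i eq_j eq_xx eq_d}.
have dK : (d *+ 2 = d -> d = 0)%R.
  by move/eqP; rewrite GRing.mulr2n -GRing.subr_eq0 GRing.addrK => /eqP.
move: ne (ltn_ord i) (ltn_ord j); rewrite -val_eqE /=.
move: (i : nat) (j : nat) => {i j}.
case=> [|[|[|i]]] [|[|[|j]]] // _ _ _; rewrite ?GRing.mulr0n ?GRing.mulr1n //.
- by move/esym/(ord_odd_double_inj n_odd).
- by move/esym/dK.
- by move/(ord_odd_double_inj n_odd).
Qed.

(* The columns are [x], [x + c] and [x + w c] over the field with four elements,
   [w] being a primitive element. *)
Definition f4_array (i : 'I_3) (c x : bool * bool) : bool * bool :=
  match val i with
  | 0 => x
  | 1 => (x.1 (+) c.1, x.2 (+) c.2)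
  | _ => (x.1 (+) c.2, x.2 (+) (c.1 (+) c.2))
  end.

Lemma orth_array_f4 : orth_array f4_array.
Proof.
split=> [[[|[|[|i]]] lt_i] [[] []] [[] []] [[] []] //|].
by move=> [[|[|[|i]]] lt_i] [[|[|[|j]]] lt_j] //= _
  [[[] []] [[] []]] [[[] []] [[] []]].
Qed.

(** A single triangle, inflated by [w]. *)
Lemma gdd_latin (w : nat) : gdd w 3 0.
Proof.
rewrite -[w]mul1n -[X in gdd _ _ X](mul0n w); apply: gdd_inflate.
by apply: (@gdd_of_triples 1 3 0 [:: (0, 1, 2)]); vm_compute.
Qed.

Lemma gdd_3_step (w n m : nat) (X : finType) (beta : 'I_3 -> X -> X -> X) :
    orth_array beta -> (forall m, ~~ odd m -> m <= 2 * w -> gdd w 3 m) ->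
  n = w * #|X| -> ~~ odd m -> m <= 2 * n -> gdd n 3 m.
Proof. by move=> oa gddw ->; apply: gdd_orth_array oa gddw. Qed.

Lemma gdd_2_3 (m : nat) : ~~ odd m -> m <= 4 -> gdd 2 3 m.
Proof.
case: m => [|[|[|[|[|m]]]]] // _ _; first exact: gdd_latin.
  exact: gdd_2_3_2.
exact: gdd_2_3_4.
Qed.

Lemma gdd_4_3 (m : nat) : ~~ odd m -> m <= 8 -> gdd 4 3 m.
Proof.
case: m => [|[|[|[|[|[|[|[|[|m]]]]]]]]] // _ _; first exact: gdd_latin.
- exact: gdd_4_3_2.
- exact: gdd_4_3_4.
- exact: gdd_4_3_6.
exact: gdd_4_3_8.
Qed.

(** An odd factor is removed by an array of odd order and a factor 4 by the array over the field
    with four elements. A factor 2 cannot be removed, since no such array of order 2 exists; hence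
    the two base sizes 2 and 4. *)
Lemma gdd_3 (n m : nat) : ~~ odd n -> ~~ odd m -> m <= 2 * n -> gdd n 3 m.
Proof.
elim/ltn_ind: n m => n IHn m even_n even_m le_m.
have [n0|n_gt0] := posnP n.
  by have [-> ->] : n = 0 /\ m = 0; [lia | exact: gdd_latin].
have step w k : odd k -> n = w * k -> (forall m, ~~ odd m -> m <= 2 * w -> gdd w 3 m) ->
    gdd n 3 m.
  case: k => // k k_odd def_n gddw.
  by apply: (gdd_3_step (orth_array_odd k_odd) gddw); rewrite ?card_ord.
have [n2_odd|n2_even] := boolP (odd n./2).
  by apply: (step 2 n./2) => //; [lia | exact: gdd_2_3].
have [n4_odd|n4_even] := boolP (odd n./2./2).
  by apply: (step 4 n./2./2) => //; [lia | exact: gdd_4_3].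
apply: (@gdd_3_step n./2./2 n m _ _ orth_array_f4) => // [m' even_m' le_m'|].
  by apply: IHn => //; lia.
by rewrite card_prod card_bool; lia.
Qed.

(** * Groups of size divisible by 6 *)

(** A one-factorization with factors indexed by [K], where [nb k x] is the partner of [x] in factor
    [k], becomes a triangle decomposition when each factor is joined to its own new point. *)
Lemma tdec_factorization (L K : finType) (e : rel L) (col : L -> L -> K) (nb : K -> L -> L) :
    symmetric e -> (forall x y, col x y = col y x) ->
    (forall k x, e x (nb k x) /\ col x (nb k x) = k) ->
    (forall x y, e x y -> nb (col x y) x = y) ->
  tdec (fun p q : L + K => match p, q with
    | inl x, inl y => e x y | inr _, inr _ => false | _, _ => true end).
Proof.
move=> e_sym colC nbP colP.
exists (fun p q => match p, q with
  | inl x, inl y => inr (col x y) | inl x, inr k => inl (nb k x)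
  | inr k, inl x => inl (nb k x) | inr _, _ => p end).
move=> [x|k] [y|k'] //.
- by move=> exy; rewrite colC colP.
- by move=> _; have [ex colx] := nbP k' x; rewrite colx.
move=> _; have [ey coly] := nbP k y; split=> //.
by congr inl; rewrite -[X in nb X _]coly colC colP // e_sym.
Qed.

Section HalfOrdinal.

Variable n : nat.
Hypothesis n_odd : odd n.+1.

(** [n.+2./2] is the inverse of 2 modulo the odd number [n.+1]. *)
Let half (x : 'I_n.+1) : 'I_n.+1 := (x *+ n.+2./2)%R.

Lemma half_double x : (half x *+ 2 = x)%R.
Proof.
rewrite -GRing.mulrnA; have -> : n.+2./2 * 2 = n.+1 + 1 by lia.
rewrite GRing.mulrnDr GRing.mulr1n Zp_mulrn.
have -> : inZp (x * n.+1) = 0%R :> 'I_n.+1 by apply: val_inj; rewrite /= modnMl.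
by rewrite GRing.add0r.
Qed.

Lemma double_half x : half (x *+ 2)%R = x.
Proof. by rewrite /half -GRing.mulrnA mulnC GRing.mulrnA half_double. Qed.

End HalfOrdinal.

(** A one-factorization of the graph in which a vertex misses only its copy on the other side. In
    factor [inl c] the [false] side is paired by reflection at c, the [true] side by reflection at c
    + u, and the two fixed points are joined. Factor [inr d] joins x on the [false] side to x + d on
    the [true] side, for d other than 0 and u. In all this makes 2 #|X| - 2 factors. *)
Lemma gdd_double_zmod (X : finZmodType) (u : X) (h : X -> X) :
    u != 0%R -> (forall x, h x *+ 2 = x)%R -> (forall x, h (x *+ 2)%R = x) ->
  gdd 2 #|X| (2 * #|X| - 2).
Proof.
move=> u_neq0 hK Kh.
have dbl_inj : injective (fun x : X => x *+ 2)%R := can_inj Kh.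
pose D := {d : X | (d != 0%R) && (d != u)}.
pose e (x y : X * bool) := x.1 != y.1.
(* The default [inl x] is meant for the difference [u], the edge between the two fixed points;
   difference 0 also falls there, but is not an edge. *)
pose cross (x y : X) : X + D := if insub (y - x)%R is Some d then inr d else inl x.
pose col (x y : X * bool) : X + D :=
  if x.2 then if y.2 then inl (h (x.1 + y.1) - u)%R else cross y.1 x.1
  else if y.2 then cross x.1 y.1 else inl (h (x.1 + y.1)%R).
pose nb (k : X + D) (x : X * bool) : X * bool :=
  match k with
  | inl c => if x.2 then if x.1 == (c + u)%R then (c, false) else ((c + u) *+ 2 - x.1, true)%R
             else if x.1 == c then (c + u, true)%R else (c *+ 2 - x.1, false)%R
  | inr d => if x.2 then (x.1 - val d, false)%R else (x.1 + val d, true)%R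
  end.
have neq_add (x d : X) : d != 0%R -> x != (x + d)%R.
  by apply: contra => /eqP eq_x; apply/eqP/(@GRing.addrI _ x); rewrite -eq_x GRing.addr0.
have neq_dbl (x c : X) : x != c -> x != (c *+ 2 - x)%R.
  apply: contra => /eqP eq_x; apply/eqP/dbl_inj.
  by rewrite GRing.mulr2n {2}eq_x GRing.addrC GRing.subrK.
have cross1 (c : X) : cross c (c + u)%R = inl c.
  rewrite /cross GRing.addrC GRing.addKr; by rewrite insubF // eqxx andbF.
have crossD (x : X) (d : D) : cross x (x + val d)%R = inr d.
  by rewrite /cross GRing.addrC GRing.addKr valK.
have crossP x y : x != y -> nb (cross x y) (x, false) = (y, true) /\
                            nb (cross x y) (y, true) = (x, false).
  move=> ne; rewrite /cross; case: insubP => /= [d _ ->|].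
    by rewrite GRing.addrC GRing.subrK GRing.opprB GRing.addrC GRing.subrK.
  rewrite GRing.subr_eq0 eq_sym ne /= negbK => /eqP def1.
  by rewrite eqxx -def1 [(x + _)%R]GRing.addrC GRing.subrK eqxx.
have fact := @tdec_factorization _ _ e col nb.
pose c (p : X * bool + (X + D)) := if p is inl x then Some x.1 else None.
apply: (gdd_introT (c := c)); first by [].
- move=> i; rewrite (@card_of_inj _ bool _ (fun a => inl (i, a))) ?card_bool // => [a b [] //|].
  case=> [[j a]|a]; rewrite inE /=; try no_fiber.
  by split=> [/eqP[->] | [b [->]] //]; exists a.
- rewrite (@card_of_inj _ (X + D)%type _ inr) => [|a b [] //|]; last first.
    by case=> [[j a]|a]; rewrite inE /=; try no_fiber; split=> // _; exists a.
  suff cD : (2 + #|{: D}|)%N = #|X| by transitivity (#|X| + #|{: D}|); [exact: card_sum | lia].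
  rewrite card_sig -(cardC (pred2 (0%R : X) u)) card2 eq_sym u_neq0; congr addn.
  by apply: eq_card => d; rewrite !inE negb_or.
apply: (eq_tdec _ (fact _ _ _ _)) => [[x|k] [y|k'] //|x y|x y|k x|x y].
- by rewrite /e eq_sym.
- by rewrite /col; case: x.2; case: y.2; rewrite // [(x.1 + _)%R]GRing.addrC.
- rewrite /e /col /nb; case: k => [k|d]; case: x => x [] /=.
  + have [->|ne] := eqVneq x (k + u)%R; rewrite /=.
      by rewrite cross1 eq_sym neq_add.
    by rewrite neq_dbl // [(x + _)%R]GRing.addrC GRing.subrK Kh GRing.addrK.
  + have [->|ne] := eqVneq x k; rewrite /=; first by rewrite cross1 neq_add.
    by rewrite neq_dbl // [(x + _)%R]GRing.addrC GRing.subrK Kh.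
  + have [d0 _] := andP (valP d); have def_x : (x = x - val d + val d)%R by rewrite GRing.subrK.
    by rewrite {1 4}def_x crossD eq_sym neq_add.
  by have [d0 _] := andP (valP d); rewrite crossD neq_add.
have half_neq (a b : X) : a != b -> a != h (a + b)%R.
  apply: contra => /eqP eq_a; apply/eqP/(@GRing.addrI _ a).
  by rewrite -[RHS]hK -eq_a GRing.mulr2n.
case: x y => x [] [y []]; rewrite /e /col /= => ne.
- rewrite GRing.subrK (negPf (half_neq _ _ ne)) hK.
  by rewrite [(x + y)%R]GRing.addrC GRing.addrK.
- by rewrite eq_sym in ne; have [_ ->] := crossP _ _ ne.
- by have [-> _] := crossP _ _ ne.
by rewrite (negPf (half_neq _ _ ne)) hK [(x + y)%R]GRing.addrC GRing.addrK.
Qed.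

Lemma gdd_odd_factorization (t : nat) : 1 < t -> odd t -> gdd 2 t (2 * t - 2).
Proof.
case: t => [|[|n]] // _ n_odd.
have := @gdd_double_zmod 'I_n.+2 1%R _ _ (half_double n_odd) (double_half n_odd).
by rewrite card_ord; apply.
Qed.

(** [E (Some i)] is the design on level [i] and the [p] shared points; [E None] covers the pairs
    between levels and those with the [n * 2] other new points. *)
Lemma gdd_levels (I : finType) (W n p : nat) :
    tdec (weighted ('I_3 * I)%type (level_rel (fun x y => x != y)) W ('I_n * bool)%type) ->
    gdd W #|I| p ->
  gdd (3 * W) #|I| (p + n * 2).
Proof.
move=> decm decp; pose T := (('I_3 * I) * 'I_W + ('I_p + 'I_n * bool))%type.
pose c (x : T) := if x is inl y then Some y.1.2 else None.
pose S i := [set x : T | match x with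
  | inl y => y.1.1 == i | inr (inl _) => true | _ => false end].
pose phi (u : ('I_3 * I) * 'I_W + 'I_n * bool) : T :=
  match u with inl y => inl y | inr q => inr (inr q) end.
pose E0 (x y : T) := match x, y with
  | inl x', inl y' => level_rel (fun a b => a != b) x'.1 y'.1
  | inl _, inr (inr _) | inr (inr _), inl _ => true
  | _, _ => false end.
pose E (j : option 'I_3) := if j is Some i then gdd_rel (S i) c else E0.
apply: (gdd_introT (c := c)) => //.
- move=> x; rewrite (@card_of_inj _ ('I_3 * 'I_W)%type _ (fun a => inl ((a.1, x), a.2))).
  + by rewrite card_prod !card_ord.
  + by move=> [a b] [a' b'] [-> ->].
  case=> [[[i y] a]|q]; rewrite inE /=; try no_fiber.
  by split=> [/eqP[->] | [b [_ ->]] //]; exists (i, a).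
- rewrite (@card_of_inj _ ('I_p + 'I_n * bool)%type _ inr) => [|a b [] //|].
    by rewrite card_sum card_prod !card_ord card_bool.
  by case=> [[[i y] a]|q]; rewrite inE /=; try no_fiber; split=> // _; exists q.
apply: (@tdec_glue _ _ E).
- move=> [[[i x] a]|[q|q]] [[[j y] b]|[q'|q']] //= ne; try by exists None.
  + have [eq_ij|ne_ij] := eqVneq i j; last by exists None; rewrite /E /= /level_rel /= ne_ij.
    by exists (Some i); rewrite /E /gdd_rel !inE /= eq_ij eqxx.
  + by exists (Some i); rewrite /E /gdd_rel !inE /= eqxx.
  + by exists (Some j); rewrite /E /gdd_rel !inE /= eqxx.
- case=> [k|] [[[i x] a]|[q|q]] [[[j y] b]|[q'|q']] //=; rewrite /gdd_rel ?andbF //.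
    by case/and3P.
  by case/andP.
- case=> [k|] [k'|] [[[i x] a]|[q|q]] [[[j y] b]|[q'|q']] //=;
    rewrite /gdd_rel !inE /= ?andbF //.
  + by case/and3P=> /eqP-> _ _ /and3P[/eqP->].
  + by case/andP=> /eqP-> _ /andP[/eqP->].
  + by case/andP=> /eqP-> _ /andP[/eqP->].
  + by case/and3P=> /eqP-> /eqP-> _ /andP[/eqP].
  + by move=> /andP[/eqP ne _] /and3P[/eqP e1 /eqP e2 _]; case: ne; rewrite e1 e2.
- case=> [k|]; first exact: gdd_rel_sym.
  case=> [[[i x] a]|[q|q]] [[[j y] b]|[q'|q']] //=.
  by rewrite /level_rel /= (eq_sym i) (eq_sym x).
case=> [i|].
  apply: decp => [|x|] //.
    rewrite (@card_of_inj _ 'I_W _ (fun a => inl ((i, x), a))) ?card_ord // => [a b [] //|].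
    case=> [[[j y] a]|[q|q]]; rewrite !inE /=; try no_fiber.
    by split=> [/andP[/eqP-> /eqP[->]] | [b [-> -> _]]]; [exists a | rewrite !eqxx].
  rewrite (@card_of_inj _ 'I_p _ (fun a => inr (inl a))) ?card_ord // => [a b [] //|].
  case=> [[[j y] a]|[q|q]]; rewrite !inE /=; try no_fiber.
  by split=> // _; exists q.
apply: (tdec_image (phi := phi)) decm.
- by move=> [u|u] [v|v] // [->].
- by move=> [[u a]|u] [[v b]|v].
- case=> [[[i x] a]|[q|q]] [[[j y] b]|[q'|q']] //=.
  by rewrite /level_rel /= (eq_sym i) (eq_sym x).
by move=> [y|[q|q]] z E0z; [exists (inl y) | case: z E0z => [?|[?|?]] | exists (inr q)].
Qed.

(** * Explicit triangle decompositions with some parallel classes *)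

(** A computable certificate that the list [s] decomposes the graph [er] on N numbered points into
    triangles, the first [q * z] of which form [q] consecutive parallel classes of [z] blocks
    each. *)
Definition master_ok (N q z : nat) (er : rel nat) (s : seq (seq nat)) : bool :=
  let B := nth [::] s in let J := iota 0 (size s) in
  let V := iota 0 N in let K := iota 0 (q * z) in
  [&& all (fun b => all (fun i => nth 0 b i < N) (iota 0 3)) s &&
      all (fun b => all (fun i => all (fun i' =>
        (i != i') ==> er (nth 0 b i) (nth 0 b i')) (iota 0 3)) (iota 0 3)) s,
      all (fun x => ~~ er x x &&
        all (fun y => er x y ==> has (fun b => (x \in b) && (y \in b)) s) V) V,
      all (fun j => all (fun j' => (j != j') ==>
        all (fun x => all (fun y => [&& x != y, x \in B j' & y \in B j'] ==> false) (B j))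
          (B j)) J) J,
      all (fun x => all (fun c => has (fun j => x \in B j) (iota (c * z) z)) (iota 0 q)) V &
      [&& all (fun j => all (fun j' =>
            (j != j') && (j %/ z == j' %/ z) ==> ~~ has (mem (B j)) (B j')) K) K,
          all (fun b => size b == 3) s, q * z <= size s & 0 < z]].

Section Master.

Variables (L : finType) (N q z : nat) (er : rel nat) (s : seq (seq nat)).
Variables (code : L -> nat) (dec : nat -> L).
Hypotheses (codeK : cancel code dec) (code_lt : forall x, code x < N).
Hypothesis decK : forall a, a < N -> code (dec a) = a.
Hypothesis s_ok : master_ok N q z er s.

Lemma tdec_master (W n : nat) :
    (forall m, ~~ odd m -> m <= 2 * W -> gdd W 3 m) -> n <= W * q ->
  tdec (weighted L (fun x y => er (code x) (code y)) W ('I_n * bool)%type).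
Proof.
move=> gddW le_n; rewrite -[q]card_ord in le_n.
have [cls clsP] := even_classes le_n.
case/and5P: s_ok => /andP[/allP lt_N /allP block_er] /allP er_block.
move=> /allP block_uniq /allP cl_block /and4P[/allP cl_uniq /allP size3 le_qz z_gt0].
pose B (j : 'I_(size s)) := nth [::] s j.
have B_s j : B j \in s by exact: mem_nth.
pose b (j : 'I_(size s)) (i : 'I_3) := dec (nth 0 (B j) i).
(* Blocks from position [q * z] on get [None]: no new points are attached to them. *)
pose k (j : 'I_(size s)) : option 'I_q := insub (j %/ z).
have in_iota m (i : 'I_m) : nat_of_ord i \in iota 0 m by rewrite mem_iota ltn_ord.
have V_code x : code x \in iota 0 N by rewrite mem_iota code_lt.
have code_b j i : code (b j i) = nth 0 (B j) i.
  by rewrite decK //; have /allP -> := lt_N _ (B_s j).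
have mem_code_b j i : code (b j i) \in B j.
  by rewrite code_b mem_nth // (eqP (size3 _ (B_s j))).
have mem_b x j : code x \in B j -> exists i, b j i = x.
  move=> /(nthP 0)[i]; rewrite (eqP (size3 _ (B_s j))) => lt_i eq_x.
  by exists (Ordinal lt_i); rewrite /b /= eq_x codeK.
apply: (@tdec_weighted _ 'I_q _ _ predT b k _ _ cls) => //.
- by move=> x; have /andP[/negPf] := er_block _ (V_code x).
- move=> j i i' _ ne; rewrite !code_b.
  have /allP/(_ _ (in_iota _ i))/allP/(_ _ (in_iota _ i'))/implyP := block_er _ (B_s j).
  exact.
- move=> x y exy; have /andP[_ /allP/(_ _ (V_code y))] := er_block _ (V_code x).
  rewrite exy => /hasP[c /(nthP [::])[j lt_j <-] /andP[xj yj]].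
  exists (Ordinal lt_j) => //.
  have [i eq_x] := mem_b x (Ordinal lt_j) xj.
  by have [i' eq_y] := mem_b y (Ordinal lt_j) yj; exists i, i'.
- move=> j j' i1 i2 i1' i2' _ _ ne eq1 eq2; apply/eqP; case: eqVneq => // ne_j.
  have /allP/(_ _ (in_iota _ j')) := block_uniq _ (in_iota _ j).
  rewrite val_eqE ne_j => /allP/(_ _ (mem_code_b j i1))/allP/(_ _ (mem_code_b j i2)).
  rewrite eq1 mem_code_b eq2 mem_code_b -eq1 -eq2 !andbT.
  case: eqP => // eq_c _.
  have /allP/(_ _ (in_iota _ i1))/allP/(_ _ (in_iota _ i2)) := block_er _ (B_s j).
  rewrite val_eqE ne -!code_b eq_c.
  by have /andP[/negPf->] := er_block _ (V_code (b j i2)).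
- move=> x c; have /allP/(_ _ (in_iota _ c))/hasP[j] := cl_block _ (V_code x).
  rewrite mem_iota => /andP[le_j lt_j] xj.
  have lt_js : j < size s.
    have := leq_mul (ltn_ord c) (leqnn z); rewrite mulSn; lia.
  exists (Ordinal lt_js) => //; split; last exact: mem_b.
  rewrite /k /=; have -> : j %/ z = c; last by rewrite valK.
  by rewrite -(subnKC le_j) divnMDl // divn_small ?addn0 //; lia.
move=> j j' i i' c _ _; rewrite /k; case: insubP => // d lt_jq def_d [<-] {c}.
case: insubP => // d' lt_jq' def_d' [eq_d] eq_b; apply/eqP; case: eqVneq => // ne_j.
have in_K (l : 'I_(size s)) : l %/ z < q -> nat_of_ord l \in iota 0 (q * z).
  by rewrite ltn_divLR // mem_iota.
have /allP/(_ _ (in_K _ lt_jq')) := cl_uniq _ (in_K _ lt_jq).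
rewrite val_eqE ne_j -def_d -def_d' eq_d eqxx => /hasP[].
by exists (code (b j i)); [rewrite eq_b | rewrite inE]; apply: mem_code_b.
Qed.

End Master.

(* A Steiner triple system on 15 points without the blocks [3 i, 3 i + 1, 3 i + 2]; the
   first five blocks listed form a parallel class. *)
Definition master5 : seq (seq nat) :=
  [:: [:: 1; 4; 6]; [:: 2; 3; 13]; [:: 0; 9; 14]; [:: 8; 10; 12]; [:: 5; 7; 11];
      [:: 0; 3; 8]; [:: 0; 4; 10]; [:: 0; 5; 12]; [:: 0; 6; 11]; [:: 0; 7; 13];
      [:: 1; 3; 11]; [:: 1; 5; 14]; [:: 1; 7; 12]; [:: 1; 8; 9]; [:: 1; 10; 13];
      [:: 2; 4; 8]; [:: 2; 5; 9]; [:: 2; 6; 14]; [:: 2; 7; 10]; [:: 2; 11; 12];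
      [:: 3; 6; 12]; [:: 3; 7; 9]; [:: 3; 10; 14]; [:: 4; 7; 14]; [:: 4; 9; 12];
      [:: 4; 11; 13]; [:: 5; 6; 10]; [:: 5; 8; 13]; [:: 6; 9; 13]; [:: 8; 11; 14]].

(* The first two families of six come from transversals of an idempotent Latin
   square of order 6; the rows, columns and symbols are numbered from 0, 6, 12. *)
Definition master6 : seq (seq nat) :=
  [:: [:: 0; 7; 17]; [:: 1; 11; 16]; [:: 2; 6; 13]; [:: 3; 10; 12]; [:: 4; 9; 14];
      [:: 5; 8; 15]; [:: 0; 8; 16]; [:: 1; 10; 14]; [:: 2; 7; 15]; [:: 3; 11; 13];
      [:: 4; 6; 17]; [:: 5; 9; 12]; [:: 0; 10; 15]; [:: 0; 9; 13]; [:: 0; 11; 14];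
      [:: 1; 6; 15]; [:: 1; 9; 17]; [:: 1; 8; 12]; [:: 2; 10; 17]; [:: 2; 9; 16];
      [:: 2; 11; 12]; [:: 3; 6; 16]; [:: 3; 7; 14]; [:: 3; 8; 17]; [:: 4; 7; 12];
      [:: 4; 8; 13]; [:: 4; 11; 15]; [:: 5; 10; 13]; [:: 5; 6; 14]; [:: 5; 7; 16]].

Lemma master5_ok : master_ok 15 1 5 (fun x y => x %/ 3 != y %/ 3) master5.
Proof. by vm_compute. Qed.

Lemma master6_ok :
  master_ok 18 2 6 (fun x y => (x %/ 6 != y %/ 6) && (x %% 6 != y %% 6)) master6.
Proof. by vm_compute. Qed.

(** The [p] points come from the designs on the levels; the [M] points are attached to the #|X| - 1
    classes off the diagonal, at most [2 * W] to each. *)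
Lemma gdd_idempotent_array (X : finType) (beta : 'I_3 -> X -> X -> X) (c0 : X) (W p M : nat) :
    orth_array beta -> (forall i x, beta i c0 x = x) -> ~~ odd W ->
    gdd W #|X| p -> ~~ odd M -> M <= 2 * W * #|X|.-1 ->
  gdd (3 * W) #|X| (p + M).
Proof.
move=> oa idem even_W decp even_M le_M; have -> : M = M./2 * 2 by lia.
apply: gdd_levels decp; apply: (tdec_idempotent_array oa idem) => [m even_m|].
  exact: gdd_3.
by rewrite -mulnA in le_M; lia.
Qed.

Lemma gdd_odd (t W p M : nat) : odd t -> ~~ odd W -> gdd W t p ->
  ~~ odd M -> M <= 2 * W * t.-1 -> gdd (3 * W) t (p + M).
Proof.
case: t => // t t_odd even_W; rewrite -[t.+1]card_ord => decp even_M le_M.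
apply: (gdd_idempotent_array (orth_array_odd t_odd) (c0 := 0%R)) => // i x.
by rewrite GRing.mul0rn GRing.addr0.
Qed.

Lemma gdd_4 (W p M : nat) : ~~ odd W -> gdd W 4 p ->
  ~~ odd M -> M <= 2 * W * 3 -> gdd (3 * W) 4 (p + M).
Proof.
have card4 : #|{: bool * bool}| = 4 by rewrite card_prod card_bool.
move=> even_W; rewrite -card4 => decp even_M le_M.
apply: (gdd_idempotent_array orth_array_f4 (c0 := (false, false))) => //.
- by move=> [[|[|[|i]]] lt_i] [a b] //; rewrite /f4_array /= !addbF.
- by rewrite card4.
Qed.

(** The levels cannot be used with [p = 0], since the 40 edges of type 2^5 do not split into
    triangles. Instead the triple system behind [master5], whose groups are three consecutive
    points, is weighted by [W]; its parallel class absorbs up to [2 * W] points. *)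
Lemma gdd_5_small (W m : nat) : ~~ odd W -> ~~ odd m -> m <= 2 * W -> gdd (3 * W) 5 m.
Proof.
move=> even_W even_m le_m; have def_m : m = m./2 * 2 by lia.
pose c (x : 'I_15 * 'I_W + 'I_m./2 * bool) : option 'I_5 :=
  if x is inl y then Some (inord (y.1 %/ 3)) else None.
have lt5 (x : 'I_15) : x %/ 3 < 5 by rewrite ltn_divLR.
have lt15 (i : 'I_5) (a : 'I_3) : i * 3 + a < 15 by have := ltn_ord i; have := ltn_ord a; lia.
apply: (gdd_introT (c := c)); first exact: card_ord.
- move=> i.
  rewrite (@card_of_inj _ ('I_3 * 'I_W)%type _ (fun y => inl (Ordinal (lt15 i y.1), y.2))).
  + by rewrite card_prod !card_ord.
  + by move=> [a b] [a' b'] [/addnI/val_inj-> ->].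
  case=> [[x a]|q]; rewrite inE /=; try no_fiber.
  split=> [/eqP[<-] | [[b a'] /= [<- _]]]; last first.
    apply/eqP; congr Some; apply: val_inj.
    by rewrite /= divnMDl // divn_small // addn0 inordK.
  exists (Ordinal (ltn_pmod x (isT : 0 < 3)), a); congr (inl (_, _)).
  by apply: val_inj; rewrite /= inordK // -divn_eq.
- rewrite (@card_of_inj _ ('I_m./2 * bool)%type _ inr) => [|a b [] //|].
    by rewrite card_prod card_ord card_bool -def_m.
  by case=> [[x a]|q]; rewrite inE /=; try no_fiber; split=> // _; exists q.
have dec : tdec (weighted 'I_15 (fun x y : 'I_15 => x %/ 3 != y %/ 3) W ('I_m./2 * bool)%type).
  apply: (tdec_master (@inord_val 14) _ (@inordK 14) master5_ok) => [x|m' even_m'|].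
  - exact: ltn_ord.
  - exact: gdd_3.
  - by lia.
apply: eq_tdec dec => -[[x a]|q] [[y b]|q'] //=.
by rewrite (inj_eq Some_inj) -val_eqE /= !inordK.
Qed.

(** There are no two orthogonal Latin squares of order 6, so the levels are joined by the explicit
    decomposition [master6]; its two parallel classes absorb up to [4 * W] points. *)
Lemma gdd_6_small (W m : nat) : ~~ odd W -> gdd W 6 0 -> ~~ odd m -> m <= 4 * W ->
  gdd (3 * W) 6 m.
Proof.
move=> even_W dec0 even_m le_m; have def_m : m = 0 + m./2 * 2 by lia.
rewrite def_m -[6]card_ord; apply: gdd_levels; last by rewrite card_ord.
pose code (x : 'I_3 * 'I_6) : nat := x.1 * 6 + x.2.
pose dec (a : nat) : 'I_3 * 'I_6 := (inord (a %/ 6), inord (a %% 6)).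
have div_code x : code x %/ 6 = x.1 by rewrite divnMDl // divn_small ?addn0.
have mod_code x : code x %% 6 = x.2 by rewrite modnMDl modn_small.
have codeK : cancel code dec.
  by move=> [i x]; rewrite /dec div_code mod_code !inord_val.
have decK a : a < 18 -> code (dec a) = a.
  by move=> lt_a; rewrite /code /= !inordK ?ltn_pmod ?ltn_divLR // -divn_eq.
have code_lt x : code x < 18.
  by rewrite /code; have := ltn_ord x.1; have := ltn_ord x.2; lia.
have := tdec_master codeK code_lt decK master6_ok.
move=> /(_ W m./2 (fun m' em' => gdd_3 even_W em')) decm.
apply: eq_tdec (decm _) => [|]; last by lia.
by case=> [[x a]|q] [[y b]|q'] //=; rewrite !div_code !mod_code.
Qed.

(** * Induction on the number of groups *)

Definition gdd_6h_at (t : nat) : Prop :=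
  forall h m, ~~ odd m -> m <= 6 * h * t.-1 -> gdd (6 * h) t m.

Lemma gdd_2_from_6 (t m : nat) : gdd 6 t m -> gdd 2 (t * 3) m.
Proof.
move=> dec; rewrite -[m]addn0; apply: (@gdd_fill 2 3) => //; exact: gdd_latin.
Qed.

(** With W = 2 h, the three classes absorb up to 12 h points. Starting from p = 0 and p = 6 h, this
    covers the ranges up to 12 h and from 6 h to 18 h. *)
Lemma gdd_6h_at_4 : gdd_6h_at 4.
Proof.
move=> h m even_m le_m; have -> : 6 * h = 3 * (2 * h) by lia.
have even_W : ~~ odd (2 * h) by rewrite oddM.
have [le_m12 | lt_12m] := leqP m (12 * h).
  rewrite -[m]add0n; apply: gdd_4 => //; last by lia.
  exact: (@gdd_inflate 2 4 0 h gdd_2_4_0).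
have -> : m = 6 * h + (m - 6 * h) by lia.
apply: gdd_4 => //; [exact: (@gdd_inflate 2 4 6 h gdd_2_4_6) | lia | lia].
Qed.

(** With g = 6 h, a long group of size 3 g + m is split into type g^3 m^1; it fits because 3 g + m
    <= 4 g <= g (t - 1). *)
Lemma gdd_6h_at_split (t h m : nat) : gdd_6h_at t -> 4 < t -> ~~ odd m -> m <= 6 * h ->
  gdd (6 * h) (t + 3) m.
Proof.
move=> claim_t t_gt4 even_m le_m; apply: gdd_split; last by apply: gdd_3; lia.
by apply: claim_t; [lia | nia].
Qed.

(** Groups of size 2 g, with g = 6 h, are halved with the help of g new points, which is a design of
    type g^3; hence the lower bound on [m]. *)
Lemma gdd_6h_at_double (s h m : nat) : gdd_6h_at s -> 2 < s -> ~~ odd m ->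
  6 * h <= m <= 6 * h * (s * 2).-1 -> gdd (6 * h) (s * 2) m.
Proof.
move=> claim_s s_gt2 even_m /andP[ge_m le_m]; have -> : m = m - 6 * h + 6 * h by lia.
apply: gdd_fill; last by apply/gddS; apply: gdd_latin.
have -> : 6 * h * 2 = 6 * (2 * h) by lia.
by apply: claim_s; [lia | nia].
Qed.

Lemma gdd_6h_at_6 : gdd_6h_at 6.
Proof.
move=> h m even_m le_m; have [le_hm | lt_mh] := leqP (6 * h) m.
  apply: (@gdd_6h_at_double 3) => //; last by rewrite le_hm.
  by move=> h' m' even_m' le_m'; apply: gdd_3; lia.
have -> : 6 * h = 3 * (2 * h) by lia.
apply: gdd_6_small => //; [lia | | lia].
exact: (@gdd_inflate 2 6 0 h gdd_2_6_0).
Qed.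

(** Three groups of size g k, with g = 6 h, take as much of [m] as they can, namely up to 2 g k;
    what is left is at most g (k - 1) and is used to fill them. *)
Lemma gdd_6h_at_triple (k : nat) : gdd_6h_at k -> 2 < k -> gdd_6h_at (3 * k).
Proof.
move=> claim_k k_gt2 h m even_m le_m.
pose M := minn m (2 * (6 * h * k)).
have -> : m = M + (m - M) by rewrite /M; lia.
apply: gdd_fill.
  by apply: gdd_3; rewrite /M; lia.
by apply: claim_k; rewrite /M; [lia | nia].
Qed.

(** The classes absorb up to 4 h (t - 1) points. Starting from p h and from (2 t - 2) h, this gives
    two overlapping ranges, the second of which ends at the maximum 6 h (t - 1). *)
Lemma gdd_6h_at_odd (t h p m : nat) : odd t -> 1 < t -> ~~ odd p -> p <= 2 ->
    gdd 2 t p -> ~~ odd m -> p * h <= m <= 6 * h * t.-1 ->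
  gdd (6 * h) t m.
Proof.
move=> t_odd t_gt1 even_p le_p decp even_m /andP[ge_m le_m].
have -> : 6 * h = 3 * (2 * h) by lia.
have even_W : ~~ odd (2 * h) by rewrite oddM.
have [le_m4 | lt_4m] := leqP m (p * h + 4 * h * t.-1).
  have -> : m = p * h + (m - p * h) by lia.
  apply: gdd_odd => //; first exact: gdd_inflate; first by nia.
  by nia.
have -> : m = (2 * t - 2) * h + (m - (2 * t - 2) * h) by nia.
apply: gdd_odd => //; first by apply: gdd_inflate; apply: gdd_odd_factorization.
  by nia.
by nia.
Qed.

Lemma gdd_6h (t : nat) : 2 < t -> gdd_6h_at t.
Proof.
elim/ltn_ind: t => t IHt t_gt2.
have IH s : s < t -> 2 < s -> gdd_6h_at s by move=> lt_st; apply: IHt.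
have [-> | t_neq4] := eqVneq t 4; first exact: gdd_6h_at_4.
have [-> | t_neq6] := eqVneq t 6; first exact: gdd_6h_at_6.
have [t_odd | t_even] := boolP (odd t); last first.
  have t_ge8 : 8 <= t by lia.
  (* Doubling reaches only m >= 6 h; for smaller m, three groups are split off the long group. *)
  move=> h m even_m le_m; have [le_hm | lt_mh] := leqP (6 * h) m.
    have def_t : t = t./2 * 2 by lia.
    by rewrite def_t; apply: gdd_6h_at_double; rewrite -?def_t ?le_hm //; [apply: IH; lia | lia].
  have -> : t = t - 3 + 3 by lia.
  by apply: gdd_6h_at_split => //; [apply: IH; lia | lia | lia].
have [r3 | ner3] := eqVneq (t %% 3) 0.
  have def_t : t = 3 * (t %/ 3) by lia.
  have [-> | t_neq3] := eqVneq t 3.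
    by move=> h m even_m le_m; apply: gdd_3; lia.
  by rewrite def_t; apply: gdd_6h_at_triple; [apply: IH; lia | lia].
move=> h m even_m le_m; have [r1 | ner1] := eqVneq (t %% 3) 1.
  (* For t = 1 mod 6, a design of type 2^t comes from one of type 6^((t-1)/3) 2^1 by cutting the
     groups of size 6 into pairs. For t = 7 just two such groups would remain, hence the table. *)
  apply: (@gdd_6h_at_odd t h 0) => //; first by lia.
  have [-> | t_neq7] := eqVneq t 7; first exact: gdd_2_7_0.
  have -> : t = ((t %/ 6 * 2) * 3).+1 by lia.
  apply/gddS/gdd_2_from_6/(IH _ _ _ 1) => //; lia.
(* For t = 5 mod 6, the 2 t (t - 1) edges of type 2^t are not a multiple of 3 in number, so the
   levels share p = 2 points per unit of h and reach only m >= 2 h. *)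
have [lt_m2 | le_2m] := ltnP m (2 * h).
  have [t5 | t_neq5] := eqVneq t 5.
    rewrite t5; have -> : 6 * h = 3 * (2 * h) by lia.
    by apply: gdd_5_small; lia.
  have -> : t = t - 3 + 3 by lia.
  by apply: gdd_6h_at_split => //; [apply: IH; lia | lia | lia].
apply: (@gdd_6h_at_odd t h 2) => //; [by lia | | by rewrite le_2m].
(* Type 2^t 2^1 is 2^(t+1), obtained by cutting the groups of type 6^((t+1)/3) into pairs; t = 5
   would leave two groups. *)
apply/gddS; have [-> | t_neq5] := eqVneq t 5; first exact: gdd_2_6_0.
have -> : t.+1 = (t %/ 6 * 2 + 2) * 3 by lia.
by apply/gdd_2_from_6/(IH _ _ _ 1) => //; lia.
Qed.

(** * Geometries on the groups of a design *)

Lemma collinearP (T : finType) (L : {set {set T}}) (x y : T) :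
  reflect (exists2 l, l \in L & x \in l /\ y \in l) (collinear L x y).
Proof.
apply: (iffP existsP) => [[l /and3P[Ll lx ly]] | [l Ll [lx ly]]]; exists l => //.
by rewrite Ll lx ly.
Qed.

(** Each point collinear with [x] and different from it is on one line through [x], and each line
    through [x] has two such points; the double count is an exchange of sums. *)
Lemma card_pls3 (T : finType) (L : {set {set T}}) (x : T) :
    partial_linear_space L -> (forall l, l \in L -> #|l| = 3) -> collinear L x x ->
  #|T| = 2 * #|[set l in L | x \in l]| + #|non_neighbours L x| + 1.
Proof.
move=> pls size3 xx; pose N := [set y | (y != x) && collinear L x y].
have -> : #|T| = #|N| + #|non_neighbours L x| + 1.
  rewrite -(cardsC (non_neighbours L x)) addnC -addnA [_ + 1]addnC addnA; congr addn.
  have -> : ~: non_neighbours L x = x |: N.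
    by apply/setP=> y; rewrite !inE negbK; case: eqVneq => //= ->.
  by rewrite cardsU1 !inE eqxx addnC.
congr (_ + _ + _); set Lx := [set l in L | _].
have sum1 y : y \in N -> \sum_(l in Lx | y \in l) 1 = 1.
  rewrite inE => /andP[ne /collinearP[l Ll [lx ly]]].
  rewrite (big_pred1 l) // => m; rewrite !inE.
  apply/idP/eqP => [/andP[/andP[Lm mx] my] | ->]; last by rewrite Ll lx ly.
  by apply: (pls x y) => //; rewrite eq_sym.
rewrite -sum1_card -(eq_bigr _ sum1) (exchange_big_dep (mem Lx)) => [|y l _ /andP[]//] /=.
rewrite (eq_bigr (fun=> 2)) => [|l]; first by rewrite sum_nat_const mulnC.
rewrite inE => /andP[Ll lx]; rewrite sum1_card.
have : #|l| = 3 := size3 l Ll; rewrite (cardsD1 x l) lx => -[<-]; apply: eq_card => y.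
rewrite -[LHS]/[&& y \in N, (l \in L) && true & y \in l] Ll !inE /=.
case: (y == x) => //=; case ly: (y \in l); rewrite ?andbF ?andbT //.
by apply/collinearP; exists l.
Qed.

Lemma collinear_refl (T : finType) (L : {set {set T}}) (k r w : nat) (x : T) :
  0 < r -> is_pent k r w L -> collinear L x x.
Proof.
move=> r_gt0 [_ _ deg _]; rewrite -(deg x) in r_gt0.
by have /card_gt0P[l] := r_gt0; rewrite inE => /andP[Ll lx]; apply/collinearP; exists l.
Qed.

Lemma card_pent (T : finType) (L : {set {set T}}) (r w : nat) (x : T) :
  0 < r -> is_pent 3 r w L -> #|T| = 2 * r + w + 1.
Proof.
move=> r_gt0 pent; have [pls size3 deg steiner] := pent.
rewrite (card_pls3 pls size3 (collinear_refl x r_gt0 pent)) deg.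
by have [B _ [-> _ _]] := steiner x.
Qed.

Section Union.

Variables (K : finType) (T_ : K -> finType) (L_ : forall k, {set {set T_ k}}).
Local Notation T := {k : K & T_ k}.
Local Notation in_ k := (fun x => @Tagged K k (fun k' => Finite.sort (T_ k')) x).
Variables (f : T -> T -> T) (r_ : K -> nat) (r w : nat).

Hypothesis fP : forall x y : T, tag x != tag y ->
  [/\ tag x != tag (f x y), f y x = f x y & f x (f x y) = y].
Hypotheses (r_gt0 : forall k, 0 < r_ k) (pent_ : forall k, is_pent 3 (r_ k) w (L_ k)).
Hypothesis cardT : #|{: T}| = 2 * r + w + 1.

Let in_inj k : injective (in_ k).
Proof. by move=> x y /eqP; rewrite eq_Tagged => /eqP. Qed.

Definition union_lines : {set {set T}} :=
  [set l : {set T} | [exists k, exists m in L_ k, l == in_ k @: m] ||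
    [exists x : T, exists y : T, (tag x != tag y) && (l == [set x; y; f x y])]].

Local Notation L := union_lines.

Lemma union_linesP l : reflect
  ((exists k, exists2 m, m \in L_ k & l = in_ k @: m) \/
   (exists x y : T, tag x != tag y /\ l = [set x; y; f x y])) (l \in L).
Proof.
rewrite inE; apply: (iffP orP) => -[].
- by case/existsP=> k /exists_inP[m Lm /eqP->]; left; exists k, m.
- by case/existsP=> x /existsP[y /andP[ne /eqP->]]; right; exists x, y.
- by case=> k [m Lm ->]; left; apply/existsP; exists k; apply/exists_inP; exists m.
by case=> x [y [ne ->]]; right; apply/existsP; exists x; apply/existsP; exists y; rewrite ne /=.
Qed.

(** A triangle is recovered from any two of its points: [fP], applied to its sides in turn,
    determines [f] on all six ordered pairs. *)
Lemma cross_line (x y a b : T) : tag x != tag y ->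
    a \in [set x; y; f x y] -> b \in [set x; y; f x y] -> a != b ->
  tag a != tag b /\ [set x; y; f x y] = [set a; b; f a b].
Proof.
move=> xy; have [xz fC fK] := fP xy; set z := f x y in xz fC fK *.
have yx : tag y != tag x by rewrite eq_sym.
have [yz _ fK'] := fP yx; rewrite fC in yz fK'.
have [_ fzx _] := fP xz; have [_ fzy _] := fP yz.
rewrite fK in fzx; rewrite fK' in fzy.
have zx : tag z != tag x by rewrite eq_sym.
have zy : tag z != tag y by rewrite eq_sym.
have perm3 (u v t : T) : [set x; y; z] =i [set u; v; t] -> [set x; y; z] = [set u; v; t].
  by move/setP.
rewrite !inE -!orbA => /or3P[] /eqP-> /or3P[] /eqP->; rewrite ?eqxx // => _.
- by split=> //; rewrite fK; apply/perm3=> u; rewrite !inE;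
    case: (u == x); case: (u == y); case: (u == z).
- by split=> //; rewrite fC; apply/perm3=> u; rewrite !inE;
    case: (u == x); case: (u == y); case: (u == z).
- by split=> //; rewrite fK'; apply/perm3=> u; rewrite !inE;
    case: (u == x); case: (u == y); case: (u == z).
- by split=> //; rewrite fzx; apply/perm3=> u; rewrite !inE;
    case: (u == x); case: (u == y); case: (u == z).
by split=> //; rewrite fzy; apply/perm3=> u; rewrite !inE;
  case: (u == x); case: (u == y); case: (u == z).
Qed.

Lemma mem_in_ k (m : {set T_ k}) (x : T_ k) : (in_ k x \in in_ k @: m) = (x \in m).
Proof. exact/mem_imset/in_inj. Qed.

Lemma collinear_cross (x y : T) : tag x != tag y -> collinear L x y.
Proof.
move=> ne; apply/collinearP; exists [set x; y; f x y]; last by rewrite !inE !eqxx orbT.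
by apply/union_linesP; right; exists x, y.
Qed.

(** Triangles of [f] meet a group at most once, so distinct points of one group can share only a
    line of its own geometry. For equal points positive degree decides. *)
Lemma collinear_in k (x y : T_ k) :
  collinear L (in_ k x) (in_ k y) = collinear (L_ k) x y.
Proof.
apply/collinearP/collinearP => [[l /union_linesP lL]|[m Lm [mx my]]]; last first.
  exists (in_ k @: m); last by rewrite !mem_in_.
  by apply/union_linesP; left; exists k, m.
case: lL => [[k' [m Lm ->]] [/imsetP[x' mx' eqx] /imsetP[y' my' eqy]] | ].
  have eq_k : k = k' := congr1 tag eqx; subst k'.
  by exists m => //; rewrite (in_inj eqx) (in_inj eqy).
case=> a [b [ne ->]] [lx ly]; have [<-|ne_xy] := eqVneq x y.
  by apply/collinearP; apply: collinear_refl (pent_ k).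
have [|/eqP//] := cross_line ne lx ly.
by rewrite (inj_eq (@in_inj k)).
Qed.

Lemma non_neighbours_in k (x : T_ k) :
  non_neighbours L (in_ k x) = in_ k @: non_neighbours (L_ k) x.
Proof.
apply/setP=> -[k' y]; rewrite inE; have [eq_k|ne_k] := eqVneq k k'.
  by subst k'; rewrite -[existT _ k y]/(in_ k y) collinear_in mem_in_ inE.
rewrite (@collinear_cross (in_ k x) (in_ k' y)) //=; apply/esym/negbTE/imsetP.
by case=> z _ eq_z; have /= eq_k := congr1 tag eq_z; rewrite eq_k eqxx in ne_k.
Qed.

Lemma union_pls : partial_linear_space L.
Proof.
move=> x y ne l l' /union_linesP Ll /union_linesP Ll' lx ly l'x l'y.
have cross a b : tag a != tag b -> x \in [set a; b; f a b] -> y \in [set a; b; f a b] ->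
    tag x != tag y /\ [set a; b; f a b] = [set x; y; f x y].
  by move=> ne_ab ax ay; apply: cross_line.
have inner k (m : {set T_ k}) : x \in in_ k @: m -> y \in in_ k @: m -> tag x = tag y.
  by move=> /imsetP[x' _ ->] /imsetP[y' _ ->].
case: Ll Ll' lx ly l'x l'y => [[k [m Lm ->]] | [a [b [ab ->]]]]
  [[k' [m' Lm' ->]] | [a' [b' [ab' ->]]]] lx ly l'x l'y.
- case/imsetP: lx ne ly l'x l'y => x' mx' -> ne /imsetP[y' my' eq_y].
  rewrite {}eq_y (inj_eq (@in_inj k)) in ne * => l'x l'y.
  have eq_k : k = k' by case/imsetP: l'x => z _ /(congr1 tag).
  subst k'; rewrite !mem_in_ in l'x l'y; congr imset.
  by have [pls _ _ _] := pent_ k; rewrite (pls x' y' ne m m').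
- by have [] := cross _ _ ab' l'x l'y; rewrite (inner _ _ lx ly) eqxx.
- by have [] := cross _ _ ab lx ly; rewrite (inner _ _ l'x l'y) eqxx.
by have [_ ->] := cross _ _ ab lx ly; have [_ ->] := cross _ _ ab' l'x l'y.
Qed.

Lemma union_size3 l : l \in L -> #|l| = 3.
Proof.
case/union_linesP => [[k [m Lm ->]] | [x [y [ne ->]]]].
  by rewrite card_imset //; have [_ size3 _ _] := pent_ k; apply: size3.
have [xz fC _] := fP ne; have [|yz _ _] := fP (x := y) (y := x); first by rewrite eq_sym.
have neq_tag (a b : T) : tag a != tag b -> a != b by apply: contra => /eqP->.
rewrite fC in yz; rewrite setUC cardsU1 cards2 !inE neq_tag // negb_or.
by rewrite !(eq_sym (f x y)) !neq_tag.
Qed.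

(** The degree is not counted directly: the non-neighbours of a point stay in its group and number
    [w], so the total number of points forces the degree by [card_pls3]. *)
Lemma union_pent : is_pent 3 r w L.
Proof.
have nonE (x : T) : exists2 B : {set {set T}}, B \subset L & steiner2 3 w (non_neighbours L x) B.
  case: x => k x; rewrite -[existT _ k x]/(in_ k x) non_neighbours_in.
  have [_ _ _ /(_ x)[B sBL [cardV sizeB pairB]]] := pent_ k.
  exists [set in_ k @: m | m : {set T_ k} in B].
    apply/subsetP=> l /imsetP[m Bm ->]; apply/union_linesP; left; exists k, m => //.
    exact: (subsetP sBL).
  split; first by rewrite card_imset.
    by move=> b /imsetP[m /sizeB[sub size] ->]; rewrite imsetS // card_imset.
  move=> _ _ /imsetP[a Va ->] /imsetP[b Vb ->]; rewrite (inj_eq (@in_inj k)) => ne.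
  have [m [/and3P[Bm ma mb] uniq_m]] := pairB a b Va Vb ne.
  exists (in_ k @: m); split; first by rewrite !mem_in_ ma mb imset_f.
  move=> _ /and3P[/imsetP[m' Bm' ->]]; rewrite !mem_in_ => m'a m'b.
  by rewrite (uniq_m m') // Bm' m'a.
split=> //; [exact: union_pls | exact: union_size3 |].
move=> x; have [B _ [cardV _ _]] := nonE x.
have xx : collinear L x x.
  case: x {nonE cardV} => k x; rewrite -[existT _ k x]/(in_ k x) collinear_in.
  exact: collinear_refl (pent_ k).
have := card_pls3 union_pls union_size3 xx; rewrite cardV cardT; lia.
Qed.

Lemma deficiency_in k (x y : T_ k) :
  deficiency_graph L (in_ k x) (in_ k y) = deficiency_graph (L_ k) x y.
Proof. by rewrite /deficiency_graph collinear_in. Qed.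

Lemma deficiency_tag (x y : T) : deficiency_graph L x y -> tag x = tag y.
Proof. by move=> dxy; apply/eqP; apply: contraR dxy => /collinear_cross. Qed.

Lemma graph_cycle_in k (c : seq (T_ k)) :
  graph_cycle (deficiency_graph L) (map (in_ k) c) = graph_cycle (deficiency_graph (L_ k)) c.
Proof.
rewrite /graph_cycle /ucycleb size_map (map_inj_uniq (@in_inj k)); congr (_ && (_ && _)).
by rewrite cycle_map; apply: eq_cycle => x y; apply: deficiency_in.
Qed.

Lemma map_in_tag k (c : seq T) :
  all (fun y => tag y == k) c -> exists c' : seq (T_ k), c = map (in_ k) c'.
Proof.
elim: c => [|[k' y] c IHc] /=; first by exists [::].
by case/andP=> /eqP eq_k /IHc[c' ->]; subst k'; exists (y :: c').
Qed.

Lemma graph_cycle_tag (c : seq T) : graph_cycle (deficiency_graph L) c ->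
  exists k (c' : seq (T_ k)), c = map (in_ k) c'.
Proof.
have tags (p : seq T) y : path (deficiency_graph L) y p -> all (fun z => tag z == tag y) p.
  elim: p y => //= z p IHp y /andP[/deficiency_tag-> /IHp ->].
  by rewrite eqxx.
case: c => [|x p] /andP[// _ /andP[cyc _]].
exists (tag x); apply: map_in_tag; rewrite /= eqxx tags //.
by move: cyc; rewrite /= rcons_path => /andP[].
Qed.

(** Points of different groups are collinear, so every cycle of the deficiency graph stays inside
    one group. *)
Lemma union_girth (g_ : K -> nat) (g : nat) :
    (forall k, has_girth (deficiency_graph (L_ k)) (g_ k)) ->
    (exists k, g_ k = g) -> (forall k, g <= g_ k) ->
  has_girth (deficiency_graph L) g.
Proof.
move=> girth_ [k <-] le_g; split=> [|c cyc].
  have [[c cyc <-] _] := girth_ k.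
  by exists (map (in_ k) c); rewrite ?size_map ?graph_cycle_in.
have [k' [c' def_c]] := graph_cycle_tag cyc.
rewrite {}def_c graph_cycle_in in cyc *; rewrite size_map.
by have [_ /(_ c' cyc)] := girth_ k'; apply: leq_trans (le_g k').
Qed.

End Union.

Lemma exists_pent_union (K : finType) (T_ : K -> finType)
    (L_ : forall k, {set {set T_ k}}) (r_ g_ : K -> nat) (r w g : nat) :
    (forall k, 0 < r_ k) -> (forall k, is_pent 3 (r_ k) w (L_ k)) ->
    (forall k, has_girth (deficiency_graph (L_ k)) (g_ k)) ->
    (exists k, g_ k = g) -> (forall k, g <= g_ k) ->
    #|{: {k : K & T_ k}}| = 2 * r + w + 1 ->
    tdec (fun x y : {k : K & T_ k} => tag x != tag y) ->
  exists_pent_girth 3 r w g.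
Proof.
move=> r_gt0 pent_ girth_ ex_g le_g cardT [f fP].
exists {k : K & T_ k}, (union_lines L_ f); split.
  exact: union_pent fP r_gt0 pent_ cardT.
exact: (union_girth fP r_gt0 pent_ girth_ ex_g le_g).
Qed.

(** The girth supplies a cycle, hence a point at which to count. *)
Lemma card_girth (T : finType) (L : {set {set T}}) (r w g : nat) :
  0 < r -> is_pent 3 r w L -> has_girth (deficiency_graph L) g -> #|T| = 2 * r + w + 1.
Proof. by move=> r_gt0 pent [[[|x c] //] _ _ _]; apply: card_pent x r_gt0 pent. Qed.

(** * Two nested designs on copies of three geometries *)

Section Combine.

Variables (T0 T1 T2 : finType) (t u : nat).

Definition sum_fam (k : 'I_u + ('I_t + unit)) : finType :=
  match k with inl _ => T2 | inr (inl _) => T1 | inr (inr _) => T0 end.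

Local Notation K := ('I_u + ('I_t + unit))%type.
Local Notation T := {k : K & sum_fam k}.
Local Notation in_ k := (fun x => @Tagged K k (fun k' => Finite.sort (sum_fam k')) x).

Let flat1 (p : 'I_t * T1 + T0) : T :=
  match p with inl q => in_ (inr (inl q.1)) q.2 | inr q => in_ (inr (inr tt)) q end.

Let flat2 (p : 'I_u * T2 + ('I_t * T1 + T0)) : T :=
  match p with inl q => in_ (inl q.1) q.2 | inr q => flat1 q end.

Let in_inj k : injective (in_ k).
Proof. by move=> x y /eqP; rewrite eq_Tagged => /eqP. Qed.

Let flat1_inj : injective flat1.
Proof.
move=> [[i a]|a] [[j b]|b] //= eq_ab; last by congr inr; apply: (in_inj eq_ab).
have [eq_ij] := congr1 tag eq_ab; subst j.
by congr (inl (_, _)); apply: (in_inj eq_ab).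
Qed.

Let flat2_inj : injective flat2.
Proof.
move=> [[i a]|p] [[j b]|q] //= eq_ab.
- have [eq_ij] := congr1 tag eq_ab; subst j.
  by congr (inl (_, _)); apply: (in_inj eq_ab).
- by case: q eq_ab => [[]|] // ? ?.
- by case: p eq_ab => [[]|] // ? ?.
by congr inr; apply: flat1_inj.
Qed.

Lemma card_sum_fam : #|{: T}| = #|T2| * u + #|T1| * t + #|T0|.
Proof.
have setT_flat x : x \in [set: T] <-> exists p, flat2 p = x; last first.
  rewrite -[LHS]cardsT (card_of_inj flat2_inj setT_flat).
  by rewrite !card_sum !card_prod !card_ord; lia.
case: x => [[i|[i|[]]] x]; rewrite inE; split=> // _.
- by exists (inl (i, x)).
- by exists (inr (inl (i, x))).
by exists (inr (inr x)).
Qed.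

(** The long group of the outer design, whose other groups are the copies of [T2], consists of [T0]
    and all copies of [T1]; it carries the inner design. *)
Lemma tdec_sum_fam :
    gdd #|T1| t #|T0| -> gdd #|T2| u (#|T1| * t + #|T0|) ->
  tdec (fun x y : T => tag x != tag y).
Proof.
move=> dec1 dec2.
pose c1 (x : T) := if tag x is inl i then Some i else None.
pose S2 := [set x : T | if tag x is inr _ then true else false].
pose c2 (x : T) := if tag x is inr (inl i) then Some i else None.
pose E (b : bool) := if b then gdd_rel [set: T] c1 else gdd_rel S2 c2.
apply: (@tdec_glue _ _ E).
- move=> [[i|[i|[]]] x] [[j|[j|[]]] y] //= ne;
    try (by exists true; rewrite /E /gdd_rel !inE);
    by exists false; rewrite /E /gdd_rel !inE.
- by case=> [] [[i|[i|[]]] x] [[j|[j|[]]] y]; rewrite /= /gdd_rel !inE.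
- by case=> [] [] [[i|[i|[]]] x] [[j|[j|[]]] y]; rewrite /= /gdd_rel !inE.
- by case; apply: gdd_rel_sym.
have in_tag k (x : T) : tag x = k <-> exists y, in_ k y = x.
  split=> [<- | [y <-] //]; by case: x => k' x; exists x.
have fibre k (A : {set T}) : (forall x, (x \in A) = (tag x == k)) -> #|A| = #|sum_fam k|.
  move=> A_k; apply: (@card_of_inj _ _ _ (in_ k)); first exact: in_inj.
  by move=> x; rewrite A_k -in_tag; split=> /eqP.
case.
  apply: dec2 => [|i|]; first exact: card_ord.
    by apply: (fibre (inl i)) => -[[j|[j|[]]] x]; rewrite !inE.
  rewrite (@card_of_inj _ _ _ flat1 flat1_inj).
    by rewrite card_sum card_prod card_ord mulnC.
  case=> [[j|[j|[]]] x]; rewrite !inE /=.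
  - by split=> [/eqP|[[[? ?]|?] /(congr1 tag)]].
  - by split=> // _; exists (inl (j, x)).
  by split=> // _; exists (inr x).
apply: dec1 => [|i|]; first exact: card_ord.
  by apply: (fibre (inr (inl i))) => -[[j|[j|[]]] x]; rewrite !inE.
by apply: (fibre (inr (inr tt))) => -[[j|[j|[]]] x]; rewrite !inE.
Qed.

End Combine.

(** Positivity of [t] and [u] makes all three geometries occur, so that the minimum of the girths is
    attained. *)
Lemma pent_combine (w r0 r1 r2 v0 v1 v2 g0 g1 g2 t u r : nat) :
    0 < r0 -> 0 < r1 -> 0 < r2 ->
    v0 = 2 * r0 + w + 1 -> v1 = 2 * r1 + w + 1 -> v2 = 2 * r2 + w + 1 ->
    exists_pent_girth 3 r0 w g0 -> exists_pent_girth 3 r1 w g1 ->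
    exists_pent_girth 3 r2 w g2 ->
    0 < t -> 0 < u -> gdd v1 t v0 -> gdd v2 u (v1 * t + v0) ->
    v2 * u + v1 * t + v0 = 2 * r + w + 1 ->
  exists_pent_girth 3 r w (minn g0 (minn g1 g2)).
Proof.
move=> r0_gt0 r1_gt0 r2_gt0 def_v0 def_v1 def_v2 [T0 [L0 [p0 gi0]]] [T1 [L1 [p1 gi1]]].
move=> [T2 [L2 [p2 gi2]]] t_gt0 u_gt0 dec1 dec2 def_r.
have c0 : #|T0| = v0 by rewrite def_v0; apply: card_girth p0 gi0.
have c1 : #|T1| = v1 by rewrite def_v1; apply: card_girth p1 gi1.
have c2 : #|T2| = v2 by rewrite def_v2; apply: card_girth p2 gi2.
pose L_ (k : 'I_u + ('I_t + unit)) : {set {set sum_fam T0 T1 T2 k}} :=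
  match k with inl _ => L2 | inr (inl _) => L1 | inr (inr _) => L0 end.
pose pick A (a0 a1 a2 : A) (k : 'I_u + ('I_t + unit)) : A :=
  match k with inl _ => a2 | inr (inl _) => a1 | inr (inr _) => a0 end.
apply: (@exists_pent_union _ _ L_ (pick _ r0 r1 r2) (pick _ g0 g1 g2)).
- by case=> [|[]].
- by case=> [|[]].
- by case=> [|[]].
- have [le01|lt10] := leqP g0 (minn g1 g2); first by exists (inr (inr tt)).
  have [le12|lt21] := leqP g1 g2; first by exists (inr (inl (Ordinal t_gt0))).
  by exists (inl (Ordinal u_gt0)).
- by case=> [?|[?|?]]; rewrite /pick /=; lia.
- by rewrite card_sum_fam c0 c1 c2.
by apply: tdec_sum_fam; rewrite c0 c1 ?c2.
Qed.

(** * Numerical conditions on the numbers of groups *)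

Lemma leq_ceil_div (a b : nat) : 0 < b -> a <= b * ceil_div a b.
Proof.
move=> b_gt0; rewrite /ceil_div {1}(divn_eq a b) mulnDr mulnC leq_add2l.
by rewrite /dvdn; case: eqP => [-> // | _]; rewrite muln1 ltnW // ltn_mod.
Qed.

(** The equation fixes t modulo b, and the window for t is a full set of residues; the bound on [n]
    keeps u nonnegative. *)
Lemma linear_solution (a b lo n : nat) : 0 < a -> 0 < b -> coprime a b ->
    a * (lo + b) <= n ->
  exists t u, [/\ lo <= t, t < lo + b & a * t + b * u = n].
Proof.
move=> a_gt0 b_gt0 co_ab le_n; pose x := chinese a b 0 n.
have /eqP xa : x == 0 %[mod a] by rewrite chinese_modl.
have xb : x = n %[mod b] by rewrite chinese_modr.
have def_x : x = a * (x %/ a) by rewrite mulnC divnK // /dvdn xa mod0n.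
(* [lo * b.-1] stands for -lo modulo b, so that [lo + s] is congruent to [x %/ a]. *)
pose s := (x %/ a + lo * b.-1) %% b.
have lt_s : s < b by rewrite ltn_mod.
have eq_lo : lo + s = x %/ a %[mod b].
  by rewrite modnDmr addnCA -mulnS prednK // addnC modnMDl.
have eq_n : a * (lo + s) = n %[mod b] by rewrite -modnMmr eq_lo modnMmr -def_x.
have le_sn : a * (lo + s) <= n.
  by apply: leq_trans le_n; rewrite leq_mul2l leq_add2l (ltnW lt_s) orbT.
exists (lo + s), ((n - a * (lo + s)) %/ b); split; first exact: leq_addr.
  by rewrite ltn_add2l.
rewrite [b * _]mulnC divnK ?subnKC //.
by rewrite -(eqn_mod_dvd _ le_sn) eq_n.
Qed.

(** Here [v] is the size of the single extra group and [r'] the degree of its geometry. Counting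
    points gives v1 t + v2 u = 2 (r - r'), that is a t + b u = (r - r') / 3. With t in the window of
    length b = v2 / 6 from [t_min] on, the term v1 v2 / 6 of [r_min] leaves enough for u to be at
    least [x_min]. *)
Lemma group_numbers (w r0 r1 r2 v0 v1 v2 r v r' : nat) :
    0 < r1 -> v1 = 2 * r1 + w + 1 -> v2 = 2 * r2 + w + 1 -> gcdn v1 v2 = 6 ->
    r_min v0 v1 v2 r0 r1 <= r -> (v = v0 \/ v = v1) ->
    v = 2 * r' + w + 1 -> r' <= maxn r0 r1 -> r = r' %[mod 3] ->
  exists a b t u, [/\ v1 = 6 * a, v2 = 6 * b, ~~ odd v, 2 < t /\ v <= v1 * t.-1 &
    [/\ 2 < u, v1 * t + v <= v2 * u.-1 & v2 * u + v1 * t + v = 2 * r + w + 1]].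
Proof.
move=> r1_gt0 def_v1 def_v2 gcd6 le_r v_or def_v le_r' eq_r.
have /dvdnP[a def_a] : 6 %| v1 by rewrite -gcd6 dvdn_gcdl.
have /dvdnP[b def_b] : 6 %| v2 by rewrite -gcd6 dvdn_gcdr.
rewrite mulnC in def_a; rewrite mulnC in def_b.
have a_gt0 : 0 < a by lia.
have b_gt0 : 0 < b by lia.
have co_ab : coprime a b.
  by rewrite /coprime -(eqn_pmul2l (isT : 0 < 6)) muln_gcdr -def_a -def_b gcd6.
have v1_gt0 : 0 < v1 by lia.
have v2_gt0 : 0 < v2 by lia.
set lo := t_min v0 v1; set X := x_min v0 v1 v2.
have lo_gt2 : 2 < lo by rewrite /lo /t_min add1n ltnS leq_maxl.
have le_v_lo : v <= v1 * lo.-1.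
  case: v_or => ->; last by rewrite -[X in X <= _]muln1 leq_mul2l; lia.
  apply: leq_trans (leq_ceil_div v0 v1_gt0) _.
  by rewrite leq_mul2l /lo /t_min add1n leq_maxr orbT.
have def_b' : v2 %/ 6 = b by rewrite def_b mulKn.
have X_gt2 : 2 < X by rewrite /X /x_min /u_min add1n ltnS leq_maxl.
(* [x_min] is [u_min] at [lo + b], the upper end of the window, and so serves every t in it; the two
   ceilings deal with [v = v1] and [v = v0]. *)
have le_X : v1 * (lo + b) + v <= v2 * X.-1.
  case: v_or => ->; apply: leq_trans (leq_ceil_div _ v2_gt0) _;
    by rewrite leq_mul2l /X /x_min /u_min add1n def_b' !leq_max !leqnn !orbT.
have le_r2 : v2 * X + v1 * lo + 2 * (v1 * b) + 2 * r' <= 2 * r.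
  have e1 : v2 * X %/ 2 * 2 = v2 * X by rewrite divnK // def_b -mulnA dvdn_mulr.
  have e2 : v1 * lo %/ 2 * 2 = v1 * lo by rewrite divnK // def_a -mulnA dvdn_mulr.
  have e3 : v1 * v2 %/ 6 = v1 * b by rewrite def_b mulnCA mulKn.
  by move: le_r; rewrite /r_min -/lo -/X e3; lia.
have def_n : r = r' + 3 * ((r - r') %/ 3).
  have le : r' <= r by lia.
  by rewrite mulnC divnK ?subnKC // -(eqn_mod_dvd _ le) eq_r.
set n := (r - r') %/ 3 in def_n.
have le_n : a * (lo + b) <= n.
  by rewrite -(leq_pmul2l (isT : 0 < 6)) mulnA -def_a mulnDr; move: le_r2; clear -def_n; lia.
have [t [u [le_t lt_t def_tu]]] := linear_solution a_gt0 b_gt0 co_ab le_n.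
have def_sum : v1 * t + v2 * u = 2 * (r - r').
  by rewrite def_a def_b -!mulnA -mulnDr def_tu; lia.
have lt_vt : v1 * t <= v1 * (lo + b) by rewrite leq_mul2l (ltnW lt_t) orbT.
have le_Xu : X <= u.
  rewrite -(leq_pmul2l v2_gt0); move: lt_vt le_r2; rewrite mulnDr; lia.
exists a, b, t, u; split=> //.
- by lia.
- split; first exact: leq_trans lo_gt2 le_t.
  by apply: leq_trans le_v_lo _; rewrite leq_mul2l; apply/orP; right; lia.
split; first exact: leq_trans X_gt2 le_Xu.
  apply: (@leq_trans (v2 * X.-1)); first by lia.
  by rewrite leq_mul2l; apply/orP; right; lia.
by lia.
Qed.

Theorem theorem3p2 (w r0 r1 r2 v0 v1 v2 g0 g1 g2 : nat)
  (hw : 3 <= w)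
  (hr0 : 0 < r0) (hr1 : 0 < r1) (hr2 : 0 < r2)
  (hv0 : v0 = 2 * r0 + w + 1)
  (hv1 : v1 = 2 * r1 + w + 1)
  (hv2 : v2 = 2 * r2 + w + 1)
  (hP0 : exists_pent_girth 3 r0 w g0)
  (hP1 : exists_pent_girth 3 r1 w g1)
  (hP2 : exists_pent_girth 3 r2 w g2)
  (hr0mod : r0 = 0 %[mod 3])
  (hr1mod : r1 <> 0 %[mod 3])
  (hr2mod : r2 <> 0 %[mod 3])
  (hgcd : gcdn v1 v2 = 6)
  (r : nat)
  (hr : r_min v0 v1 v2 r0 r1 <= r)
  (hrmod : r = 0 %[mod 3] \/ r = w + 1 %[mod 3]) :
  (r = 0 %[mod 3] -> exists_pent_girth 3 r w (minn g0 (minn g1 g2))) /\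
  (r <> 0 %[mod 3] -> exists_pent_girth 3 r w (minn g1 g2)).
Proof.
have build v r' g : v = v0 \/ v = v1 -> 0 < r' -> v = 2 * r' + w + 1 ->
    exists_pent_girth 3 r' w g -> r' <= maxn r0 r1 -> r = r' %[mod 3] ->
    exists_pent_girth 3 r w (minn g (minn g1 g2)).
  move=> v_or r'_gt0 def_v P le_r' eq_r.
  have [a [b [t [u [def_a def_b even_v [t_gt2 le_v] [u_gt2 le_vu def_r]]]]]] :=
    group_numbers hr1 hv1 hv2 hgcd hr v_or def_v le_r' eq_r.
  apply: (pent_combine r'_gt0 hr1 hr2 def_v hv1 hv2 P hP1 hP2 _ _ _ _ def_r).
  - by lia.
  - by lia.
  - by rewrite def_a; apply: gdd_6h; rewrite -?def_a.
  rewrite def_b; apply: gdd_6h; rewrite -?def_b //.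
  by rewrite def_a oddD -mulnA oddM.
split=> eq_r; first by apply: (build v0 r0 g0) => //; [left | rewrite leq_maxl | rewrite eq_r].
(* The extra group now carries one more copy of the second geometry, so [g0] does not enter. *)
rewrite -[g1 in minn g1]minnn -minnA; apply: (build v1 r1 g1) => //.
- by right.
- by rewrite leq_maxr.
(* As 3 divides v1 = 2 r1 + w + 1, the degree r1 is congruent to w + 1, hence to r. *)
have /dvdnP[a def_a] : 6 %| v1 by rewrite -hgcd dvdn_gcdl.
by case: hrmod => // ->; lia.
Qed.
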